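(* Let $\varphi$ be analytic with positive real part in $\mathbb{D}$, with $\varphi(0)=1$, $\varphi'(0)>0$, $\varphi(\mathbb{D})$ symmetric with respect to the real axis, and Taylor expansion $\varphi(z)=1+B_1z+B_2z^2+B_3z^3+\cdots$ (so $B_1>0$). If $f(z)=z+\sum_{n=2}^{\infty}a_nz^n$ belongs to the class $\mathcal{ST}_{\sigma}(\varphi)$, then $$|a_2|\le\frac{B_1\sqrt{B_1}}{\sqrt{|B_1^2+B_1-B_2|}}\qquad\text{and}\qquad |a_3|\le B_1+|B_2-B_1|.$$
   Context: $\mathbb{D}=\{z\in\mathbb{C}:|z|<1\}$. $\mathcal{A}$ is the class of analytic functions $f$ on $\mathbb{D}$ with $f(0)=0$ and $f'(0)=1$. A function is univalent if it is analytic and injective. A function $f\in\mathcal{A}$ is bi-univalent if both $f$ and its inverse $f^{-1}$ are univalent in $\mathbb{D}$; that is, $f$ is univalent in $\mathbb{D}$ and the inverse of $f$, defined near $0$, extends to a univalent function on $\mathbb{D}$, still denoted $g=f^{-1}$. The class of bi-univalent functions is $\sigma$. An analytic function $F$ on $\mathbb{D}$ is subordinate to an analytic function $G$ on $\mathbb{D}$, written $F\prec G$, if there is an analytic $w:\mathbb{D}\to\mathbb{D}$ with $w(0)=0$ and $F(z)=G(w(z))$ for all $z\in\mathbb{D}$. A function $f\in\sigma$ is in $\mathcal{ST}_{\sigma}(\varphi)$ (bi-starlike of Ma-Minda type) if $$\frac{zf'(z)}{f(z)}\prec\varphi(z)\quad\text{and}\quad \frac{wg'(w)}{g(w)}\prec\varphi(w),\qquad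 g=f^{-1}$$ (the quotients are taken with their removable singularity at $0$ filled in). Convention: a bound whose denominator vanishes is regarded as $+\infty$ (no assertion). *)

(* Defs.v *)
From Stdlib Require Import Reals.
From Coquelicot Require Import Coquelicot.
Open Scope C_scope.

(* Functions on the unit disc are total functions [C -> C]; only their values
   at points of the disc matter. *)

Definition in_disc (z : C) : Prop := (Cmod z < 1)%R.

Definition analytic_on_disc (f : C -> C) : Prop :=
  forall z : C, in_disc z -> @ex_derive C_AbsRing C_NormedModule f z.

Definition maps_disc_to_disc (w : C -> C) : Prop :=
  forall z : C, in_disc z -> in_disc (w z).

Definition injective_on_disc (f : C -> C) : Prop :=
  forall z1 z2 : C, in_disc z1 -> in_disc z2 -> f z1 = f z2 -> z1 = z2.

Definition univalent (f : C -> C) : Prop :=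
  analytic_on_disc f /\ injective_on_disc f.

Definition class_A (f : C -> C) : Prop :=
  analytic_on_disc f /\ f 0 = 0 /\ C_derive f 0 = 1.

Definition taylor_expansion (f : C -> C) (a : nat -> C) : Prop :=
  forall z : C, in_disc z -> @is_pseries C_AbsRing C_NormedModule a z (f z).

(* Near 0, [g w] is a preimage of [w] under [f] lying in the disc. *)
Definition extends_inverse (f g : C -> C) : Prop :=
  exists r : R, (0 < r)%R /\
    forall w : C, (Cmod w < r)%R -> in_disc (g w) /\ f (g w) = w.

(* [f] is bi-univalent and [g], univalent in the disc, is the extension of
   its inverse; [g] is determined by [f] on the disc. *)
Definition bi_univalent_with_inverse (f g : C -> C) : Prop :=
  class_A f /\ univalent f /\ univalent g /\ extends_inverse f g.

Definition subordinate (F G : C -> C) : Prop :=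
  exists w : C -> C,
    analytic_on_disc w /\ maps_disc_to_disc w /\ w 0 = 0 /\
    forall z : C, in_disc z -> F z = G (w z).

(* z f'(z) / f(z). For f(0) = 0 and f'(0) <> 0 the limit at 0 is 1. *)
Definition starlike_quotient (f : C -> C) (z : C) : C :=
  if Ceq_dec z 0 then 1 else z * C_derive f z / f z.

Definition ST_sigma (phi f : C -> C) : Prop :=
  exists g : C -> C,
    bi_univalent_with_inverse f g /\
    subordinate (starlike_quotient f) phi /\
    subordinate (starlike_quotient g) phi.

Definition image_symmetric_real_axis (phi : C -> C) : Prop :=
  forall z : C, in_disc z ->
    exists z' : C, in_disc z' /\ phi z' = Cconj (phi z).

Definition ma_minda (phi : C -> C) : Prop :=
  analytic_on_disc phi /\
  (forall z : C, in_disc z -> (0 < Re (phi z))%R) /\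
  phi 0 = 1 /\
  (Im (C_derive phi 0) = 0%R /\ (0 < Re (C_derive phi 0))%R) /\
  image_symmetric_real_axis phi.

(* Main.v *)
Require Import Defs.
From Stdlib Require Import Reals Lra Lia.
From Coquelicot Require Import Coquelicot.
Open Scope C_scope.

(** Why the bounds hold. Write the two subordinations through Schwarz functions
    [u(z) = u1 z + u2 z^2 + o(z^2)] for [f] and [v(w) = v1 w + v2 w^2 + o(w^2)]
    for the inverse [g]. Comparing coefficients up to order 2 gives
    - [a2 = B1 u1] and [2 a3 - a2^2 = B1 u2 + B2 u1^2],
    - [- a2 = B1 v1] and [3 a2^2 - 2 a3 = B1 v2 + B2 v1^2].
    Hence [v1 = - u1]. With [s = u2 + u1^2] and [t = v2 + v1^2], eliminating
    yields
    - [2 a2^2 (B1^2 + B1 - B2) = B1^3 (s + t)],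
    - [4 a3 = B1 (3 s + t) + 4 (B2 - B1) u1^2],
    and both bounds follow from [|u1|, |s|, |t| <= 1].

    These three inequalities ([schwarz_coefficients]) come from the bound 2 on
    the coefficients of a function [p] of positive real part with [p(0) = 1],
    applied to [p = (1 + u) / (1 - u)], whose second coefficient is [2 s]. That
    bound ([caratheodory_coef]) is obtained by integrating [p] against a
    nonnegative trigonometric weight over circles. The only fact of complex
    analysis it needs is that the integral over a circle of a function
    differentiable on the punctured disc is independent of the radius
    ([circle_int_radius_indep]); in logarithmic coordinates this is Goursat's
    theorem on a rectangle ([goursat_rect]), proved by bisection.

    Schwarz functions and inverses are given only as differentiable functions,
    so their expansions are derived rather than assumed: [jet2] is a calculus
    of expansions of order 2 at the origin, closed under products, inverses and
    composition, in which an equation [F o h = G] can be solved for [h]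
    ([jet2_solve]). The expansions of [phi], [f] and [f'] themselves come from
    the Taylor series ([jet2_taylor], [jet2_C_derive]). *)

(** * Complex differentiation *)

(** The filter formulation of the derivative is unfolded once and for all:
    every estimate below is an explicit epsilon-delta one. *)
Lemma is_derive_C_iff : forall (f : C -> C) (z l : C),
  @is_derive C_AbsRing C_NormedModule f z l <->
  (forall eps : R, (0 < eps)%R -> exists delta : R, (0 < delta)%R /\
     forall y : C, (Cmod (y - z) < delta)%R ->
       (Cmod (f y - f z - l * (y - z)) <= eps * Cmod (y - z))%R).
Proof.
  intros f z l; split.
  - intros [_ H] eps Heps.
    destruct (H z (fun P HP => HP) (mkposreal eps Heps)) as [d Hd].
    exists d; split; [apply cond_pos|].
    intros y Hy.
    specialize (Hd y Hy).
    change (Cmod (f y - f z - (y - z) * l) <= eps * Cmod (y - z))%R in Hd.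
    rewrite (Cmult_comm (y - z) l) in Hd. exact Hd.
  - intros H; split.
    + apply is_linear_scal_l.
    + intros x Hx eps.
      assert (E : z = x).
      { apply (@is_filter_lim_locally_unique C_AbsRing
                 (AbsRing_NormedModule C_AbsRing) z x Hx). }
      subst x.
      destruct (H eps (cond_pos eps)) as [d [Hd0 Hd]].
      exists (mkposreal d Hd0); intros y Hy.
      specialize (Hd y Hy).
      change (Cmod (f y - f z - (y - z) * l) <= eps * Cmod (y - z))%R.
      rewrite (Cmult_comm (y - z) l). exact Hd.
Qed.

Notation C_differentiable f z := (@ex_derive C_AbsRing C_NormedModule f z).

Lemma ex_derive_C_plus : forall (f g : C -> C) z,
  C_differentiable f z -> C_differentiable g z ->
  C_differentiable (fun x => f x + g x) z.
Proof. intros f g z Hf Hg. exact (ex_derive_plus f g z Hf Hg). Qed.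

(** The plane carries two uniform structures, one from the product of the
    lines and one from the modulus; general product and chain rules speak of
    the second, while differentiability on the disc speaks of the first. A
    derivative only sees the norm, which is the same in both. *)
Lemma is_derive_C_ring : forall (f : C -> C) (z l : C),
  @is_derive C_AbsRing C_NormedModule f z l <->
  @is_derive C_AbsRing (AbsRing_NormedModule C_AbsRing) f z l.
Proof.
  intros f z l; split; intros [_ H].
  - split; [apply is_linear_scal_l|exact H].
  - split; [apply (is_linear_scal_l (V := C_NormedModule) l)|exact H].
Qed.

Lemma ex_derive_C_mult : forall (f g : C -> C) z,
  C_differentiable f z -> C_differentiable g z ->
  C_differentiable (fun x => f x * g x) z.
Proof.
  intros f g z [df Hf] [dg Hg]. eexists. apply is_derive_C_ring.
  apply is_derive_C_ring in Hf; apply is_derive_C_ring in Hg.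
  exact (@is_derive_mult C_AbsRing f g z df dg Hf Hg Cmult_comm).
Qed.

Lemma ex_derive_C_comp : forall (f g : C -> C) z,
  C_differentiable f (g z) -> C_differentiable g z ->
  C_differentiable (fun x => f (g x)) z.
Proof.
  intros f g z [df Hf] [dg Hg]. eexists.
  apply is_derive_C_ring in Hg.
  exact (is_derive_comp (K := C_AbsRing) (V := C_NormedModule) f g z df dg Hf Hg).
Qed.

Lemma ex_derive_C_id : forall z, C_differentiable (fun x => x) z.
Proof. intros z. exists (RtoC 1). apply is_derive_C_ring. exact (@is_derive_id C_AbsRing z). Qed.

Lemma ex_derive_C_const : forall (c z : C), C_differentiable (fun _ => c) z.
Proof. intros c z. exact (@ex_derive_const C_AbsRing C_NormedModule c z). Qed.

Lemma Cmod_triangle_minus : forall x y : C, (Cmod (x - y) <= Cmod x + Cmod y)%R.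
Proof.
  intros x y. unfold Cminus. rewrite <- (Cmod_opp y). apply Cmod_triangle.
Qed.

Lemma Cmod_minus_sym : forall x y : C, Cmod (x - y) = Cmod (y - x).
Proof.
  intros x y. rewrite <- Cmod_opp. f_equal. ring.
Qed.

Lemma Cmod_minus_ge : forall x y : C, (Cmod x - Cmod (y - x) <= Cmod y)%R.
Proof.
  intros x y.
  pose proof (Cmod_triangle y (x - y)) as H.
  replace (y + (x - y)) with x in H by ring.
  rewrite (Cmod_minus_sym x y) in H. lra.
Qed.

(** The error term is exactly the square of [y - z] divided by [y z^2], so it
    suffices to keep [y] away from 0. *)
Lemma is_derive_C_inv : forall z : C, z <> 0 ->
  @is_derive C_AbsRing C_NormedModule (fun x => / x) z (- / (z * z)).
Proof.
  intros z Hz. apply is_derive_C_iff; intros eps Heps.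
  pose proof (proj1 (Cmod_gt_0 z) Hz) as Hm.
  set (m := Cmod z) in *.
  exists (Rmin (m / 2) (eps * (m * m * m) / 2)).
  assert (0 < eps * (m * m * m) / 2)%R.
  { apply Rdiv_lt_0_compat; [|lra]. repeat apply Rmult_lt_0_compat; lra. }
  split; [apply Rmin_pos; lra|].
  intros y Hy.
  assert (Hy1 : (Cmod (y - z) < m / 2)%R) by (eapply Rlt_le_trans; [exact Hy|apply Rmin_l]).
  assert (Hy2 : (Cmod (y - z) < eps * (m * m * m) / 2)%R)
    by (eapply Rlt_le_trans; [exact Hy|apply Rmin_r]).
  pose proof (Cmod_minus_ge z y) as Hy3. fold m in Hy3.
  assert (Hy0 : y <> 0) by (apply Cmod_gt_0; lra).
  replace (/ y - / z - - / (z * z) * (y - z)) with ((y - z) * (y - z) * / (y * (z * z)))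
    by (field; auto).
  rewrite !Cmod_mult, Cmod_inv, !Cmod_mult by (repeat apply Cmult_neq_0; auto).
  fold m.
  rewrite (Rmult_comm eps), Rmult_assoc.
  apply Rmult_le_compat_l; [apply Cmod_ge_0|].
  apply (Rmult_le_reg_r (Cmod y * (m * m))).
  { repeat apply Rmult_lt_0_compat; lra. }
  rewrite Rmult_assoc, Rinv_l by (apply Rgt_not_eq; repeat apply Rmult_lt_0_compat; lra).
  apply Rle_trans with (eps * (m * m * m) / 2)%R; [lra|].
  replace (eps * (m * m * m) / 2)%R with (eps * (m / 2 * (m * m)))%R by field.
  apply Rmult_le_compat_l; [lra|].
  apply Rmult_le_compat_r; [nra|lra].
Qed.

Lemma ex_derive_C_inv : forall (f : C -> C) z,
  C_differentiable f z -> f z <> 0 -> C_differentiable (fun x => / f x) z.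
Proof.
  intros f z Hf Hz.
  apply (ex_derive_C_comp (fun x => / x) f z); [|exact Hf].
  eexists. apply is_derive_C_inv; exact Hz.
Qed.

Lemma ex_derive_C_pow : forall n z, C_differentiable (fun x => x ^ n) z.
Proof.
  induction n as [|n IH]; intros z; simpl.
  - apply ex_derive_C_const.
  - apply ex_derive_C_mult; [apply ex_derive_C_id|apply IH].
Qed.

Lemma ex_derive_C_continuous : forall (f : C -> C) z, C_differentiable f z ->
  forall eps : R, (0 < eps)%R -> exists delta : R, (0 < delta)%R /\
     forall y : C, (Cmod (y - z) < delta)%R -> (Cmod (f y - f z) < eps)%R.
Proof.
  intros f z [l Hl] eps Heps.
  destruct (proj1 (is_derive_C_iff f z l) Hl 1%R Rlt_0_1) as [d [Hd H]].
  pose proof (Cmod_ge_0 l) as Hl0.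
  assert (Hp : (0 < eps / (Cmod l + 1))%R) by (apply Rdiv_lt_0_compat; lra).
  exists (Rmin d (eps / (Cmod l + 1))); split; [apply Rmin_pos; auto|].
  intros y Hy.
  assert (Hy1 : (Cmod (y - z) < d)%R) by (eapply Rlt_le_trans; [exact Hy|apply Rmin_l]).
  assert (Hy2 : (Cmod (y - z) < eps / (Cmod l + 1))%R)
    by (eapply Rlt_le_trans; [exact Hy|apply Rmin_r]).
  specialize (H y Hy1).
  pose proof (Cmod_triangle (f y - f z - l * (y - z)) (l * (y - z))) as T.
  replace (f y - f z - l * (y - z) + l * (y - z)) with (f y - f z) in T by ring.
  rewrite Cmod_mult in T.
  apply (Rmult_lt_compat_r (Cmod l + 1)) in Hy2; [|lra].
  replace (eps / (Cmod l + 1) * (Cmod l + 1))%R with eps in Hy2 by (field; lra).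
  lra.
Qed.

(** * Integrals of complex-valued functions *)

(** Integration over a real interval regards the plane as a real normed space,
    whose product norm is again the modulus. *)
Lemma norm_C_R : forall z : C, @norm R_AbsRing C_R_NormedModule z = Cmod z.
Proof.
  intros [x y]. unfold norm; simpl. unfold prod_norm, Cmod; simpl.
  f_equal. unfold norm; simpl. unfold abs; simpl.
  rewrite !Rmult_1_r, <- !Rabs_mult, !Rabs_pos_eq; auto; nra.
Qed.

Lemma continuous_R_C : forall (F : R -> C) (t : R),
  (forall eps : R, (0 < eps)%R -> exists delta : R, (0 < delta)%R /\
     forall u : R, (Rabs (u - t) < delta)%R -> (Cmod (F u - F t) < eps)%R) ->
  @continuous R_UniformSpace C_UniformSpace F t.
Proof.
  intros F t H P [eps HP].
  destruct (H eps (cond_pos eps)) as [d [Hd Hd']].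
  exists (mkposreal d Hd); intros u Hu. apply HP.
  apply (C_NormedModule_mixin_compat1 (F t) (F u)). apply Hd'. exact Hu.
Qed.

Notation is_CInt F a b l := (@is_RInt C_R_NormedModule F a b l).
Notation CInt F a b := (@RInt C_R_CompleteNormedModule F a b).
Notation ex_CInt F a b := (@ex_RInt C_R_NormedModule F a b).

Lemma is_CInt_pair : forall (F : R -> C) (a b l1 l2 : R),
  is_RInt (fun t => Re (F t)) a b l1 -> is_RInt (fun t => Im (F t)) a b l2 ->
  is_CInt F a b (l1, l2).
Proof.
  intros F a b l1 l2 H1 H2.
  exact (is_RInt_fct_extend_pair (U := R_NormedModule) (V := R_NormedModule) F a b l1 l2 H1 H2).
Qed.

Lemma is_CInt_Re : forall (F : R -> C) (a b : R) (l : C),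
  is_CInt F a b l -> is_RInt (fun t => Re (F t)) a b (Re l).
Proof.
  intros F a b l H.
  exact (is_RInt_fct_extend_fst (U := R_NormedModule) (V := R_NormedModule) F a b l H).
Qed.

Lemma is_CInt_Im : forall (F : R -> C) (a b : R) (l : C),
  is_CInt F a b l -> is_RInt (fun t => Im (F t)) a b (Im l).
Proof.
  intros F a b l H.
  exact (is_RInt_fct_extend_snd (U := R_NormedModule) (V := R_NormedModule) F a b l H).
Qed.

Lemma is_CInt_ext : forall (F G : R -> C) (a b : R) (l : C),
  (forall t, F t = G t) ->
  is_CInt F a b l -> is_CInt G a b l.
Proof. intros F G a b l H. apply is_RInt_ext. intros t _. apply H. Qed.

Lemma is_CInt_plus : forall (F G : R -> C) (a b : R) (l m : C),
  is_CInt F a b l -> is_CInt G a b m ->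
  is_CInt (fun t => F t + G t) a b (l + m).
Proof. intros. exact (is_RInt_plus (V := C_R_NormedModule) F G a b l m H H0). Qed.

Lemma is_CInt_minus : forall (F G : R -> C) (a b : R) (l m : C),
  is_CInt F a b l -> is_CInt G a b m ->
  is_CInt (fun t => F t - G t) a b (l - m).
Proof. intros. exact (is_RInt_minus (V := C_R_NormedModule) F G a b l m H H0). Qed.

(** The integral is only known to be real-linear, so a complex factor has to
    be split into its real and imaginary parts. *)
Lemma is_CInt_scal : forall (k : C) (F : R -> C) (a b : R) (l : C),
  is_CInt F a b l ->
  is_CInt (fun t => k * F t) a b (k * l).
Proof.
  intros k F a b l H.
  pose proof (is_CInt_Re _ _ _ _ H) as H1. pose proof (is_CInt_Im _ _ _ _ H) as H2.
  apply (is_CInt_pair (fun t => k * F t)).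
  - exact (is_RInt_minus (V := R_NormedModule) _ _ a b _ _
      (is_RInt_scal (V := R_NormedModule) _ a b (Re k) _ H1)
      (is_RInt_scal (V := R_NormedModule) _ a b (Im k) _ H2)).
  - exact (is_RInt_plus (V := R_NormedModule) _ _ a b _ _
      (is_RInt_scal (V := R_NormedModule) _ a b (Re k) _ H2)
      (is_RInt_scal (V := R_NormedModule) _ a b (Im k) _ H1)).
Qed.

Lemma is_CInt_conj : forall (F : R -> C) (a b : R) (l : C),
  is_CInt F a b l ->
  is_CInt (fun t => Cconj (F t)) a b (Cconj l).
Proof.
  intros F a b l H.
  pose proof (is_CInt_Re _ _ _ _ H) as H1. pose proof (is_CInt_Im _ _ _ _ H) as H2.
  apply (is_CInt_pair (fun t => Cconj (F t))); [exact H1|].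
  exact (is_RInt_opp (V := R_NormedModule) _ a b _ H2).
Qed.

Lemma is_CInt_const : forall (c : C) (a b : R),
  is_CInt (fun _ => c) a b ((b - a)%R * c).
Proof.
  intros c a b.
  pose proof (is_RInt_const (V := C_R_NormedModule) a b c) as H.
  replace ((b - a)%R * c) with (scal (b - a)%R c : C_R_NormedModule); [exact H|].
  destruct c as [x y]. unfold scal; simpl. unfold prod_scal, scal; simpl.
  unfold mult; simpl. unfold Cmult; simpl. f_equal; ring.
Qed.

Lemma CInt_norm_le : forall (F : R -> C) (a b M : R) (l : C), (a <= b)%R ->
  (forall t : R, (a <= t <= b)%R -> (Cmod (F t) <= M)%R) ->
  is_CInt F a b l -> (Cmod l <= (b - a) * M)%R.
Proof.
  intros F a b M l Hab H Hl. rewrite <- norm_C_R.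
  apply (norm_RInt_le_const (V := C_R_NormedModule) F a b l M Hab); [|exact Hl].
  intros t Ht. rewrite norm_C_R. apply H, Ht.
Qed.

Lemma CInt_correct : forall (F : R -> C) (a b : R),
  ex_CInt F a b -> is_CInt F a b (CInt F a b).
Proof. intros F a b H. exact (RInt_correct (V := C_R_CompleteNormedModule) F a b H). Qed.

Lemma CInt_eq : forall (F : R -> C) (a b : R) (l : C),
  is_CInt F a b l -> CInt F a b = l.
Proof. intros. exact (is_RInt_unique (V := C_R_CompleteNormedModule) _ _ _ _ H). Qed.

(** * Additive functions of rectangles *)

Definition rect_additive (Phi : R -> R -> R -> R -> C) (a b c d : R) : Prop :=
  (forall x1 x x2 y1 y2, (a <= x1 <= x /\ x <= x2 <= b /\ c <= y1 <= y2 /\ y2 <= d)%R ->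
     Phi x1 x2 y1 y2 = Phi x1 x y1 y2 + Phi x x2 y1 y2) /\
  (forall x1 x2 y1 y y2, (a <= x1 <= x2 /\ x2 <= b /\ c <= y1 <= y /\ y <= y2 <= d)%R ->
     Phi x1 x2 y1 y2 = Phi x1 x2 y1 y + Phi x1 x2 y y2).

Record rect := Rect { xl : R; xr : R; yl : R; yr : R }.

(** The threshold is quadratic in the half-perimeter, hence is divided by 4
    when both sides are halved: this is what makes largeness pass to one of
    the quarters. *)
Definition large (Phi : R -> R -> R -> R -> C) (eps : R) (q : rect) : Prop :=
  (eps * (xr q - xl q + (yr q - yl q)) ^ 2 < Cmod (Phi (xl q) (xr q) (yl q) (yr q)))%R.

Lemma large_dec : forall Phi eps q, {large Phi eps q} + {~ large Phi eps q}.
Proof. intros; apply Rlt_dec. Qed.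

Definition quarter (right top : bool) (q : rect) : rect :=
  let mx := ((xl q + xr q) / 2)%R in let my := ((yl q + yr q) / 2)%R in
  Rect (if right then mx else xl q) (if right then xr q else mx)
       (if top then my else yl q) (if top then yr q else my).

(** Largeness is a decidable comparison of real numbers, so the quarter to
    keep is a function of the rectangle and the nested sequence is defined by
    plain recursion. *)
Definition large_quarter Phi eps (q : rect) : rect :=
  if large_dec Phi eps (quarter false false q) then quarter false false q
  else if large_dec Phi eps (quarter false true q) then quarter false true q
  else if large_dec Phi eps (quarter true false q) then quarter true false q
  else quarter true true q.

Definition inside (a b c d : R) (q : rect) : Prop :=
  (a <= xl q <= xr q /\ xr q <= b /\ c <= yl q <= yr q /\ yr q <= d)%R.

Lemma large_quarter_is_quarter : forall Phi eps q,
  exists right top, large_quarter Phi eps q = quarter right top q.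
Proof.
  intros Phi eps q. unfold large_quarter.
  repeat destruct large_dec; eauto.
Qed.

(** If no quarter were large, the triangle inequality applied to the four
    pieces would contradict the largeness of the whole. *)
Lemma large_quarter_large : forall Phi a b c d eps q,
  rect_additive Phi a b c d -> inside a b c d q ->
  large Phi eps q -> large Phi eps (large_quarter Phi eps q).
Proof.
  intros Phi a b c d eps q [Hx Hy] Hq HL. unfold large_quarter.
  destruct large_dec as [h|n1]; [exact h|].
  destruct large_dec as [h|n2]; [exact h|].
  destruct large_dec as [h|n3]; [exact h|].
  destruct (large_dec Phi eps (quarter true true q)) as [h|n4]; [exact h|exfalso].
  destruct q as [x1 x2 y1 y2]; unfold inside in Hq; simpl in Hq.
  unfold large in *; simpl in *.
  apply Rnot_lt_le in n1, n2, n3, n4.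
  set (mx := ((x1 + x2) / 2)%R) in *. set (my := ((y1 + y2) / 2)%R) in *.
  assert (x1 <= mx <= x2)%R by (unfold mx; lra).
  assert (y1 <= my <= y2)%R by (unfold my; lra).
  rewrite (Hx x1 mx x2 y1 y2), (Hy x1 mx y1 my y2), (Hy mx x2 y1 my y2) in HL by lra.
  pose proof (Cmod_triangle (Phi x1 mx y1 my + Phi x1 mx my y2)
                            (Phi mx x2 y1 my + Phi mx x2 my y2)).
  pose proof (Cmod_triangle (Phi x1 mx y1 my) (Phi x1 mx my y2)).
  pose proof (Cmod_triangle (Phi mx x2 y1 my) (Phi mx x2 my y2)).
  assert (E1 : (mx = x1 + (x2 - x1) / 2)%R) by (unfold mx; lra).
  assert (E2 : (my = y1 + (y2 - y1) / 2)%R) by (unfold my; lra).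
  assert (F : forall u v, (eps * ((u + v) * ((u + v) * 1)) = eps * (u + v) ^ 2)%R) by (intros; ring).
  replace (mx - x1)%R with ((x2 - x1) / 2)%R in * by (unfold mx; field).
  replace (x2 - mx)%R with ((x2 - x1) / 2)%R in * by (unfold mx; field).
  replace (my - y1)%R with ((y2 - y1) / 2)%R in * by (unfold my; field).
  replace (y2 - my)%R with ((y2 - y1) / 2)%R in * by (unfold my; field).
  nra.
Qed.

Fixpoint shrink Phi eps (q : rect) (n : nat) : rect :=
  match n with O => q | S n => large_quarter Phi eps (shrink Phi eps q n) end.

Lemma quarter_inside : forall a b c d right top q,
  inside a b c d q -> inside a b c d (quarter right top q).
Proof.
  intros a b c d right top [x1 x2 y1 y2] H; unfold inside in *; simpl in *.
  destruct right, top; lra.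
Qed.

Lemma shrink_inside : forall Phi eps q a b c d n,
  inside a b c d q -> inside a b c d (shrink Phi eps q n).
Proof.
  intros Phi eps q a b c d n H. induction n as [|n IH]; simpl; [exact H|].
  destruct (large_quarter_is_quarter Phi eps (shrink Phi eps q n)) as [r [t ->]].
  apply quarter_inside, IH.
Qed.

Lemma shrink_size : forall Phi eps q n,
  (xr (shrink Phi eps q n) - xl (shrink Phi eps q n) = (xr q - xl q) / 2 ^ n /\
   yr (shrink Phi eps q n) - yl (shrink Phi eps q n) = (yr q - yl q) / 2 ^ n)%R.
Proof.
  intros Phi eps q n. induction n as [|n [IH1 IH2]]; simpl; [lra|].
  destruct (large_quarter_is_quarter Phi eps (shrink Phi eps q n)) as [r [t ->]].
  assert (2 ^ n <> 0)%R by (apply pow_nonzero; lra).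
  replace ((xr q - xl q) / (2 * 2 ^ n))%R with ((xr q - xl q) / 2 ^ n / 2)%R by (field; auto).
  replace ((yr q - yl q) / (2 * 2 ^ n))%R with ((yr q - yl q) / 2 ^ n / 2)%R by (field; auto).
  rewrite <- IH1, <- IH2.
  destruct r, t; simpl; lra.
Qed.

Lemma shrink_add : forall Phi eps q m n,
  shrink Phi eps q (n + m) = shrink Phi eps (shrink Phi eps q m) n.
Proof. induction n as [|n IH]; simpl; [|rewrite IH]; reflexivity. Qed.

(** The least upper bound of the left endpoints is below every right endpoint.
    *)
Lemma nested_intervals : forall u v : nat -> R,
  (forall n m, (n <= m)%nat -> (u n <= u m /\ u m <= v m /\ v m <= v n)%R) ->
  exists x, forall n, (u n <= x <= v n)%R.
Proof.
  intros u v H.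
  destruct (completeness (fun t => exists n, t = u n)) as [x [Hub Hlub]].
  - exists (v O). intros t [n ->]. destruct (H O n); [lia|lra].
  - exists (u O); eauto.
  - exists x. intros n; split.
    + apply Hub; eauto.
    + apply Hlub. intros t [m ->].
      destruct (Nat.le_ge_cases n m) as [L|L].
      * destruct (H n m L); lra.
      * destruct (H m n L) ; destruct (H n n); try lia; lra.
Qed.

Lemma pow2_small : forall S delta : R, (0 < delta)%R -> exists n, (S / 2 ^ n < delta)%R.
Proof.
  intros S delta Hd.
  destruct (Pow_x_infinity 2 ltac:(rewrite Rabs_pos_eq; lra) (Rabs S / delta + 1)) as [n Hn].
  exists n. specialize (Hn n (le_n n)).
  pose proof (pow_lt 2 n ltac:(lra)) as Hp.
  rewrite Rabs_pos_eq in Hn by lra.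
  apply (Rmult_lt_reg_r (2 ^ n)); [lra|].
  unfold Rdiv at 1. rewrite Rmult_assoc, Rinv_l, Rmult_1_r by lra.
  pose proof (Rle_abs S).
  assert (Rabs S = delta * (Rabs S / delta))%R by (field; lra).
  nra.
Qed.

(** Bisection: a nonzero value makes the whole rectangle large for some
    threshold, the large quarters shrink to a point, and at that point small
    rectangles are not large. *)
Lemma rect_additive_zero : forall Phi a b c d,
  (a <= b)%R -> (c <= d)%R -> rect_additive Phi a b c d ->
  (forall x y eps, (a <= x <= b)%R -> (c <= y <= d)%R -> (0 < eps)%R ->
     exists delta, (0 < delta)%R /\
       forall q, inside a b c d q -> (xl q <= x <= xr q)%R -> (yl q <= y <= yr q)%R ->
         (xr q - xl q + (yr q - yl q) < delta)%R -> ~ large Phi eps q) ->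
  Phi a b c d = 0.
Proof.
  intros Phi a b c d Hab Hcd Hadd Hloc.
  apply Cmod_eq_0. apply Rle_antisym; [|apply Cmod_ge_0].
  apply Rnot_lt_le; intros Hpos.
  set (P := Cmod (Phi a b c d)) in *.
  set (Q := ((b - a + (d - c)) ^ 2)%R).
  assert (HQ : (0 <= Q)%R) by (unfold Q; nra).
  (* Adding 1 keeps the denominator positive for a degenerate rectangle. *)
  assert (Heps : (0 < P / (Q + 1))%R) by (apply Rdiv_lt_0_compat; lra).
  set (eps := (P / (Q + 1))%R) in *.
  set (q0 := Rect a b c d).
  assert (Hin0 : inside a b c d q0) by (unfold inside; simpl; lra).
  assert (HL0 : large Phi eps q0).
  { unfold large; simpl xl; simpl xr; simpl yl; simpl yr. fold Q P.
    assert (eps * (Q + 1) = P)%R by (unfold eps; field; lra). nra. }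
  set (q := shrink Phi eps q0).
  assert (Hin : forall n, inside a b c d (q n)) by (intros n; apply shrink_inside, Hin0).
  assert (HL : forall n, large Phi eps (q n)).
  { induction n as [|n IH]; [exact HL0|].
    exact (large_quarter_large Phi a b c d eps (q n) Hadd (Hin n) IH). }
  assert (Hmono : forall n m, (n <= m)%nat ->
            inside (xl (q n)) (xr (q n)) (yl (q n)) (yr (q n)) (q m)).
  { intros n m Hnm. replace m with ((m - n) + n)%nat by lia.
    unfold q at 5. rewrite shrink_add. apply shrink_inside.
    fold (q n). pose proof (Hin n) as I. unfold inside in *. lra. }
  destruct (nested_intervals (fun n => xl (q n)) (fun n => xr (q n))) as [x Hx].
  { intros n m Hnm. specialize (Hmono n m Hnm). unfold inside in Hmono. lra. }
  destruct (nested_intervals (fun n => yl (q n)) (fun n => yr (q n))) as [y Hy].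
  { intros n m Hnm. specialize (Hmono n m Hnm). unfold inside in Hmono. lra. }
  destruct (Hloc x y eps) as [delta [Hdelta Hsmall]];
    [exact (Hx O)|exact (Hy O)|exact Heps|].
  destruct (pow2_small (b - a + (d - c)) delta Hdelta) as [n Hn].
  apply (Hsmall (q n)); auto.
  destruct (shrink_size Phi eps q0 n) as [S1 S2]. fold (q n) in S1, S2.
  simpl in S1, S2. rewrite S1, S2. unfold Rdiv in *. lra.
Qed.

(** * Goursat's theorem on rectangles *)

(** The integral of [H] along the boundary of the rectangle, counterclockwise.
    *)
Definition rect_int (H : C -> C) (a b c d : R) : C :=
  CInt (fun x => H (x, c)) a b - CInt (fun x => H (x, d)) a b
  + Ci * (CInt (fun y => H (b, y)) c d - CInt (fun y => H (a, y)) c d).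

Definition C_differentiable_on_rect (H : C -> C) (a b c d : R) : Prop :=
  forall x y, (a <= x <= b)%R -> (c <= y <= d)%R -> C_differentiable H (x, y).

Lemma Cmod_pair_le : forall x y : R, (Cmod (x, y) <= Rabs x + Rabs y)%R.
Proof.
  intros x y. replace (x, y) with (RtoC x + Ci * RtoC y).
  - eapply Rle_trans; [apply Cmod_triangle|].
    rewrite Cmod_mult, Cmod_Ci, !Cmod_R. lra.
  - unfold Cplus, Cmult, Ci, RtoC; simpl. f_equal; ring.
Qed.

Lemma ex_CInt_horizontal : forall H x1 x2 y, (x1 <= x2)%R ->
  (forall x, (x1 <= x <= x2)%R -> C_differentiable H (x, y)) ->
  ex_CInt (fun x => H (x, y)) x1 x2.
Proof.
  intros H x1 x2 y Hx HD. apply (ex_RInt_continuous (V := C_R_CompleteNormedModule)).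
  intros x. rewrite Rmin_left, Rmax_right by exact Hx. intros Hxx.
  apply (continuous_R_C (fun x => H (x, y))). intros eps Heps.
  destruct (ex_derive_C_continuous H (x, y) (HD x Hxx) eps Heps) as [d [Hd Hd']].
  exists d; split; [exact Hd|]. intros u Hu. apply Hd'.
  replace ((u, y) - (x, y)) with (RtoC (u - x)).
  - rewrite Cmod_R. exact Hu.
  - unfold Cminus, Cplus, Copp, RtoC; simpl. f_equal; ring.
Qed.

Lemma ex_CInt_vertical : forall H x y1 y2, (y1 <= y2)%R ->
  (forall y, (y1 <= y <= y2)%R -> C_differentiable H (x, y)) ->
  ex_CInt (fun y => H (x, y)) y1 y2.
Proof.
  intros H x y1 y2 Hx HD. apply (ex_RInt_continuous (V := C_R_CompleteNormedModule)).
  intros y. rewrite Rmin_left, Rmax_right by exact Hx. intros Hyy.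
  apply (continuous_R_C (fun y => H (x, y))). intros eps Heps.
  destruct (ex_derive_C_continuous H (x, y) (HD y Hyy) eps Heps) as [d [Hd Hd']].
  exists d; split; [exact Hd|]. intros u Hu. apply Hd'.
  replace ((x, u) - (x, y)) with (Ci * RtoC (u - y)).
  - rewrite Cmod_mult, Cmod_Ci, Cmod_R. lra.
  - unfold Cminus, Cplus, Copp, Cmult, Ci, RtoC; simpl. f_equal; ring.
Qed.

Lemma CInt_Chasles : forall (F : R -> C) a b c, ex_CInt F a b -> ex_CInt F b c ->
  CInt F a c = CInt F a b + CInt F b c.
Proof.
  intros F a b c H1 H2. symmetry.
  exact (RInt_Chasles (V := C_R_CompleteNormedModule) F a b c H1 H2).
Qed.

Lemma rect_int_additive : forall H a b c d,
  C_differentiable_on_rect H a b c d -> rect_additive (rect_int H) a b c d.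
Proof.
  intros H a b c d HD; split.
  - intros x1 x x2 y1 y2 Hq. unfold rect_int.
    rewrite (CInt_Chasles (fun x => H (x, y1)) x1 x x2), (CInt_Chasles (fun x => H (x, y2)) x1 x x2)
      by (apply ex_CInt_horizontal; [lra|intros; apply HD; lra]).
    ring.
  - intros x1 x2 y1 y y2 Hq. unfold rect_int.
    rewrite (CInt_Chasles (fun y => H (x1, y)) y1 y y2), (CInt_Chasles (fun y => H (x2, y)) y1 y y2)
      by (apply ex_CInt_vertical; [lra|intros; apply HD; lra]).
    ring.
Qed.

Lemma is_RInt_affine : forall p q a b : R,
  is_RInt (fun t => p + q * t)%R a b (p * (b - a) + q * (b * b - a * a) / 2)%R.
Proof.
  intros p q a b.
  replace (p * (b - a) + q * (b * b - a * a) / 2)%R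
    with (minus (p * b + q * (b * b) / 2) (p * a + q * (a * a) / 2))%R
    by (unfold minus, plus, opp; simpl; field).
  apply (is_RInt_derive (fun t => p * t + q * (t * t) / 2)%R).
  - intros t _. auto_derive; [exact I|field].
  - intros t _. apply (ex_derive_continuous (K := R_AbsRing) (V := R_NormedModule)).
    auto_derive. exact I.
Qed.

Lemma is_CInt_affine : forall (p q : C) (a b : R),
  is_CInt (fun t => p + q * RtoC t) a b
    (p * RtoC (b - a) + q * RtoC ((b * b - a * a) / 2)).
Proof.
  intros p q a b.
  replace (p * RtoC (b - a) + q * RtoC ((b * b - a * a) / 2))
   with ((Re p * (b - a) + Re q * (b * b - a * a) / 2)%R,
         (Im p * (b - a) + Im q * (b * b - a * a) / 2)%R).
  - apply (is_CInt_pair (fun t => p + q * RtoC t)).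
    + eapply is_RInt_ext; [|apply is_RInt_affine]. intros t _; simpl. unfold Re; ring.
    + eapply is_RInt_ext; [|apply is_RInt_affine]. intros t _; simpl. unfold Im; ring.
  - destruct p as [p1 p2], q as [q1 q2]. unfold Cplus, Cmult, RtoC; simpl. f_equal; field.
Qed.

(** An affine function has a primitive; here the four sides are integrated
    explicitly and cancel. *)
Lemma rect_int_affine : forall (p q : C) a b c d,
  rect_int (fun z => p + q * z) a b c d = 0.
Proof.
  intros p q a b c d. unfold rect_int.
  assert (Hh : forall y, CInt (fun x => p + q * (x, y)) a b =
      (p + q * Ci * RtoC y) * RtoC (b - a) + q * RtoC ((b * b - a * a) / 2)).
  { intros y. apply CInt_eq.
    eapply is_CInt_ext; [|apply (is_CInt_affine (p + q * Ci * RtoC y) q)].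
    intros x.
    replace ((x, y) : C) with (RtoC x + Ci * RtoC y); [ring|].
    unfold Cplus, Cmult, Ci, RtoC; simpl; f_equal; ring. }
  assert (Hv : forall x, CInt (fun y => p + q * (x, y)) c d =
      (p + q * RtoC x) * RtoC (d - c) + q * Ci * RtoC ((d * d - c * c) / 2)).
  { intros x. apply CInt_eq.
    eapply is_CInt_ext; [|apply (is_CInt_affine (p + q * RtoC x) (q * Ci))].
    intros y.
    replace ((x, y) : C) with (RtoC x + Ci * RtoC y); [ring|].
    unfold Cplus, Cmult, Ci, RtoC; simpl; f_equal; ring. }
  rewrite !Hh, !Hv, !RtoC_minus. ring.
Qed.

Lemma rect_int_norm_le : forall H q M,
  C_differentiable_on_rect H (xl q) (xr q) (yl q) (yr q) ->
  (xl q <= xr q)%R -> (yl q <= yr q)%R ->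
  (forall x y, (xl q <= x <= xr q)%R -> (yl q <= y <= yr q)%R -> (Cmod (H (x, y)) <= M)%R) ->
  (Cmod (rect_int H (xl q) (xr q) (yl q) (yr q)) <= 2 * (xr q - xl q + (yr q - yl q)) * M)%R.
Proof.
  intros H [a b c d] M; simpl; intros HD Hab Hcd HM. unfold rect_int.
  assert (Hh : forall y, (c <= y <= d)%R -> (Cmod (CInt (fun x => H (x, y)) a b) <= (b - a) * M)%R).
  { intros y Hy. apply (CInt_norm_le (fun x => H (x, y))); auto.
    apply CInt_correct, ex_CInt_horizontal; auto. }
  assert (Hv : forall x, (a <= x <= b)%R -> (Cmod (CInt (fun y => H (x, y)) c d) <= (d - c) * M)%R).
  { intros x Hx. apply (CInt_norm_le (fun y => H (x, y))); auto.
    apply CInt_correct, ex_CInt_vertical; auto. }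
  eapply Rle_trans; [apply Cmod_triangle|].
  rewrite Cmod_mult, Cmod_Ci.
  pose proof (Cmod_triangle_minus (CInt (fun x => H (x, c)) a b) (CInt (fun x => H (x, d)) a b)).
  pose proof (Cmod_triangle_minus (CInt (fun y => H (b, y)) c d) (CInt (fun y => H (a, y)) c d)).
  pose proof (Hh c ltac:(lra)). pose proof (Hh d ltac:(lra)).
  pose proof (Hv a ltac:(lra)). pose proof (Hv b ltac:(lra)). lra.
Qed.

Lemma rect_int_plus : forall H K q,
  C_differentiable_on_rect H (xl q) (xr q) (yl q) (yr q) ->
  C_differentiable_on_rect K (xl q) (xr q) (yl q) (yr q) ->
  (xl q <= xr q)%R -> (yl q <= yr q)%R ->
  rect_int (fun z => H z + K z) (xl q) (xr q) (yl q) (yr q) =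
  rect_int H (xl q) (xr q) (yl q) (yr q) + rect_int K (xl q) (xr q) (yl q) (yr q).
Proof.
  intros H K [a b c d]; simpl; intros HD KD Hab Hcd. unfold rect_int.
  assert (Hh : forall y, (c <= y <= d)%R ->
     CInt (fun x => H (x, y) + K (x, y)) a b =
     CInt (fun x => H (x, y)) a b + CInt (fun x => K (x, y)) a b).
  { intros y Hy. apply CInt_eq, is_CInt_plus; apply CInt_correct, ex_CInt_horizontal; auto. }
  assert (Hv : forall x, (a <= x <= b)%R ->
     CInt (fun y => H (x, y) + K (x, y)) c d =
     CInt (fun y => H (x, y)) c d + CInt (fun y => K (x, y)) c d).
  { intros x Hx. apply CInt_eq, is_CInt_plus; apply CInt_correct, ex_CInt_vertical; auto. }
  rewrite !Hh, !Hv by lra. ring.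
Qed.

Lemma Cmod_in_rect_le : forall q x y x0 y0,
  (xl q <= x <= xr q)%R -> (yl q <= y <= yr q)%R ->
  (xl q <= x0 <= xr q)%R -> (yl q <= y0 <= yr q)%R ->
  (Cmod ((x, y) - (x0, y0)) <= xr q - xl q + (yr q - yl q))%R.
Proof.
  intros q x y x0 y0 H1 H2 H3 H4.
  eapply Rle_trans; [exact (Cmod_pair_le (x + - x0) (y + - y0))|].
  apply Rplus_le_compat; apply Rabs_le; lra.
Qed.

Lemma ex_derive_C_affine : forall p q z : C, C_differentiable (fun z => p + q * z) z.
Proof.
  intros p q z. apply ex_derive_C_plus; [apply ex_derive_C_const|].
  apply ex_derive_C_mult; [apply ex_derive_C_const|apply ex_derive_C_id].
Qed.

(** Near a point, [H] is affine up to an error small compared to the distance.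
    The affine part contributes nothing, and the error integrates to something
    small compared to the square of the half-perimeter, so no small rectangle
    around the point is large. *)
Lemma goursat_rect : forall H a b c d, (a <= b)%R -> (c <= d)%R ->
  C_differentiable_on_rect H a b c d -> rect_int H a b c d = 0.
Proof.
  intros H a b c d Hab Hcd HD.
  apply rect_additive_zero; auto; [apply rect_int_additive, HD|].
  intros x0 y0 eps Hx Hy Heps.
  destruct (HD x0 y0 Hx Hy) as [L HL].
  destruct (proj1 (is_derive_C_iff _ _ _) HL (eps / 2)%R ltac:(lra)) as [delta [Hdelta Happ]].
  exists delta; split; [exact Hdelta|]. intros q Hq Hqx Hqy Hsize.
  set (z0 := (x0, y0) : C) in *. unfold large. apply Rle_not_lt.
  destruct Hq as [Q1 [Q2 [Q3 Q4]]].
  set (S := (xr q - xl q + (yr q - yl q))%R) in *.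
  (* [e] is the error of the affine approximation at [z0]. *)
  set (e := fun z => H z + ((L * z0 - H z0) + (- L) * z)).
  assert (De : C_differentiable_on_rect e (xl q) (xr q) (yl q) (yr q)).
  { intros x y Hx' Hy'. apply ex_derive_C_plus; [apply HD; lra|apply ex_derive_C_affine]. }
  assert (DH : C_differentiable_on_rect H (xl q) (xr q) (yl q) (yr q)).
  { intros x y Hx' Hy'. apply HD; lra. }
  assert (E : rect_int H (xl q) (xr q) (yl q) (yr q) = rect_int e (xl q) (xr q) (yl q) (yr q)).
  { unfold e. rewrite (rect_int_plus H (fun z => (L * z0 - H z0) + (- L) * z)) by
      (try lra; auto; intros ? ? _ _; apply ex_derive_C_affine).
    rewrite rect_int_affine. ring. }
  rewrite E.
  assert (HS : (0 <= S)%R) by (unfold S; lra).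
  eapply Rle_trans; [apply (rect_int_norm_le e q (eps / 2 * S)); try lra; auto|].
  - intros x y Hx' Hy'.
    pose proof (Cmod_in_rect_le q x y x0 y0 Hx' Hy' Hqx Hqy) as HC. fold z0 S in HC.
    eapply Rle_trans; [|apply Rmult_le_compat_l; [lra|exact HC]].
    unfold e. replace (H (x, y) + (L * z0 - H z0 + - L * (x, y)))
      with (H (x, y) - H z0 - L * ((x, y) - z0)) by ring.
    apply Happ. lra.
  - fold S. lra.
Qed.

(** * The complex exponential *)

Definition cexp (z : C) : C := ((exp (Re z) * cos (Im z))%R, (exp (Re z) * sin (Im z))%R).

Lemma cexp_plus : forall z w, cexp (z + w) = cexp z * cexp w.
Proof.
  intros [x y] [s t]. unfold cexp, Cplus, Cmult; simpl.
  rewrite exp_plus, cos_plus, sin_plus. f_equal; ring.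
Qed.

Lemma Cmod_cexp : forall z, Cmod (cexp z) = exp (Re z).
Proof.
  intros [x y]. unfold cexp, Cmod; simpl.
  pose proof (sin2_cos2 y) as H. unfold Rsqr in H.
  replace (exp x * cos y * (exp x * cos y * 1) + exp x * sin y * (exp x * sin y * 1))%R
    with (exp x * exp x * (sin y * sin y + cos y * cos y))%R by ring.
  rewrite H, Rmult_1_r. apply sqrt_square. left; apply exp_pos.
Qed.

Lemma cexp_neq_0 : forall z, cexp z <> 0.
Proof. intros z. apply Cmod_gt_0. rewrite Cmod_cexp. apply exp_pos. Qed.

Lemma derivable_at_0_approx : forall (f : R -> R) (l : R), derivable_pt_lim f 0 l ->
  forall eps : R, (0 < eps)%R -> exists delta : R, (0 < delta)%R /\
    forall h : R, (Rabs h < delta)%R -> (Rabs (f h - f 0 - l * h) <= eps * Rabs h)%R.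
Proof.
  intros f l H eps Heps. destruct (H eps Heps) as [d Hd].
  exists d; split; [apply cond_pos|]. intros h Hh.
  destruct (Req_dec h 0) as [->|Hn].
  - rewrite Rmult_0_r, Rminus_diag, Rminus_0_r, Rabs_R0. lra.
  - specialize (Hd h Hn Hh). rewrite Rplus_0_l in Hd.
    replace (f h - f 0 - l * h)%R with (((f h - f 0) / h - l) * h)%R by (field; auto).
    rewrite Rabs_mult. apply Rmult_le_compat_r; [apply Rabs_pos|lra].
Qed.

(** The real expansions of exp, cos and sin at 0 give the error coordinate by
    coordinate. *)
Lemma is_derive_cexp_0 : @is_derive C_AbsRing C_NormedModule cexp (RtoC 0) (RtoC 1).
Proof.
  apply is_derive_C_iff. intros eps Heps.
  set (e := Rmin 1 (eps / 8)).
  assert (He : (0 < e)%R) by (apply Rmin_pos; lra).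
  assert (He1 : (e <= 1)%R) by apply Rmin_l.
  assert (He8 : (e <= eps / 8)%R) by apply Rmin_r.
  pose proof (derivable_pt_lim_exp 0) as De. rewrite exp_0 in De.
  pose proof (derivable_pt_lim_cos 0) as Dc. rewrite sin_0 in Dc.
  pose proof (derivable_pt_lim_sin 0) as Ds. rewrite cos_0 in Ds.
  destruct (derivable_at_0_approx _ _ De e He) as [d1 [Hd1 A1]].
  destruct (derivable_at_0_approx _ _ Dc e He) as [d2 [Hd2 A2]].
  destruct (derivable_at_0_approx _ _ Ds e He) as [d3 [Hd3 A3]].
  rewrite exp_0 in A1. rewrite cos_0 in A2. rewrite sin_0 in A3.
  exists (Rmin e (Rmin d1 (Rmin d2 d3))).
  split; [repeat apply Rmin_pos; lra|].
  intros [x y] Hxy.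
  assert (E0 : forall z : C, z - 0 = z) by (intros z; ring).
  rewrite E0 in *.
  pose proof (Rmax_Cmod (x, y)) as HM; simpl in HM.
  pose proof (Rmax_l (Rabs x) (Rabs y)). pose proof (Rmax_r (Rabs x) (Rabs y)).
  pose proof (Rmin_l e (Rmin d1 (Rmin d2 d3))). pose proof (Rmin_r e (Rmin d1 (Rmin d2 d3))).
  pose proof (Rmin_l d1 (Rmin d2 d3)). pose proof (Rmin_r d1 (Rmin d2 d3)).
  pose proof (Rmin_l d2 d3). pose proof (Rmin_r d2 d3).
  set (m := Cmod (x, y)) in *.
  specialize (A1 x ltac:(lra)). specialize (A2 y ltac:(lra)). specialize (A3 y ltac:(lra)).
  pose proof (Rabs_pos x). pose proof (Rabs_pos y).
  replace (cexp (x, y) - cexp 0 - 1 * (x, y)) with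
   (((exp x - 1 - 1 * x) * cos y + (1 + x) * (cos y - 1 - - 0 * y),
     (exp x - 1 - 1 * x) * sin y + (x * sin y + (sin y - 0 - 1 * y)))%R : C).
  2:{ unfold cexp, Cminus, Cplus, Copp, Cmult, RtoC; simpl.
      rewrite exp_0, cos_0, sin_0. f_equal; ring. }
  eapply Rle_trans; [apply Cmod_pair_le|].
  set (a1 := (exp x - 1 - 1 * x)%R) in *. set (a2 := (cos y - 1 - - 0 * y)%R) in *.
  assert (Hs : (Rabs (sin y) <= 2 * Rabs y)%R).
  { replace (sin y) with ((sin y - 0 - 1 * y) + y)%R by ring.
    eapply Rle_trans; [apply Rabs_triang|]. nra. }
  set (a3 := (sin y - 0 - 1 * y)%R) in *.
  assert (C1 : (Rabs (cos y) <= 1)%R) by (apply Rabs_le, COS_bound).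
  assert (C2 : (Rabs (sin y) <= 1)%R) by (apply Rabs_le, SIN_bound).
  assert (T1 : (Rabs (a1 * cos y) <= e * m)%R)
    by (rewrite Rabs_mult; pose proof (Rabs_pos (cos y)); pose proof (Rabs_pos a1); nra).
  assert (T2 : (Rabs (a1 * sin y) <= e * m)%R)
    by (rewrite Rabs_mult; pose proof (Rabs_pos (sin y)); pose proof (Rabs_pos a1); nra).
  assert (T3 : (Rabs ((1 + x) * a2) <= 2 * (e * m))%R).
  { rewrite Rabs_mult. pose proof (Rabs_triang 1 x) as T. rewrite Rabs_R1 in T.
    pose proof (Rabs_pos a2). pose proof (Rabs_pos (1 + x)).
    apply Rmult_le_compat; nra. }
  assert (T4 : (Rabs (x * sin y) <= 2 * (e * m))%R).
  { rewrite Rabs_mult. pose proof (Rabs_pos (sin y)).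
    apply Rle_trans with (e * (2 * m))%R; [apply Rmult_le_compat; lra|lra]. }
  assert (T5 : (Rabs a3 <= e * m)%R) by nra.
  pose proof (Rabs_triang (a1 * cos y) ((1 + x) * a2)).
  pose proof (Rabs_triang (a1 * sin y) (x * sin y + a3)).
  pose proof (Rabs_triang (x * sin y) a3).
  assert (0 <= m)%R by lra. nra.
Qed.

(** The functional equation transports differentiability from the origin to
    every point. *)
Lemma ex_derive_cexp : forall z, C_differentiable cexp z.
Proof.
  intros z.
  apply (ex_derive_ext (fun x => cexp z * cexp (- z + 1 * x))).
  { intros x. rewrite <- cexp_plus. f_equal. ring. }
  apply ex_derive_C_mult; [apply ex_derive_C_const|].
  apply (ex_derive_C_comp cexp (fun x => - z + 1 * x)); [|apply ex_derive_C_affine].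
  replace (- z + 1 * z) with (RtoC 0) by ring.
  eexists; apply is_derive_cexp_0.
Qed.

(** * Mean values over circles *)

Definition analytic_on_punctured_disc (F : C -> C) : Prop :=
  forall z : C, z <> 0 -> in_disc z -> C_differentiable F z.

(** The circle is parametrized by the logarithm [s] of its radius. In these
    coordinates circles and radii become the sides of rectangles. *)
Definition circle_int (F : C -> C) (s : R) : C := CInt (fun t => F (cexp (s, t))) 0 (2 * PI).

Lemma cexp_in_disc : forall s t, (s < 0)%R -> in_disc (cexp (s, t)).
Proof.
  intros s t Hs. unfold in_disc. rewrite Cmod_cexp; simpl.
  rewrite <- exp_0. apply exp_increasing, Hs.
Qed.

Lemma differentiable_comp_cexp : forall (F : C -> C) (z : C), analytic_on_punctured_disc F -> (Re z < 0)%R ->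
  C_differentiable (fun z => F (cexp z)) z.
Proof.
  intros F [s t] HF Hs. apply (ex_derive_C_comp F cexp).
  - apply HF; [apply cexp_neq_0|apply cexp_in_disc, Hs].
  - apply ex_derive_cexp.
Qed.

Lemma two_pi_pos : (0 < 2 * PI)%R.
Proof. pose proof PI_RGT_0; lra. Qed.

Lemma circle_int_correct : forall F s, analytic_on_punctured_disc F -> (s < 0)%R ->
  is_CInt (fun t => F (cexp (s, t))) 0 (2 * PI) (circle_int F s).
Proof.
  intros F s HF Hs. pose proof two_pi_pos.
  apply CInt_correct, (ex_CInt_vertical (fun z => F (cexp z))); [lra|].
  intros y _. apply differentiable_comp_cexp; auto.
Qed.

Lemma cexp_2PI : forall s, cexp (s, (2 * PI)%R) = cexp (s, 0%R).
Proof.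
  intros s. unfold cexp; simpl. rewrite cos_2PI, sin_2PI, cos_0, sin_0. reflexivity.
Qed.

(** Goursat's theorem for [F] composed with the exponential, on the rectangle
    of height [2 PI] between the two logarithmic radii: the horizontal sides
    cancel by periodicity, and the vertical ones are the two circle integrals.
    This holds on the punctured disc, so poles at the origin are allowed. *)
Lemma circle_int_radius_indep_le : forall F s1 s2, analytic_on_punctured_disc F ->
  (s1 <= s2 < 0)%R -> circle_int F s1 = circle_int F s2.
Proof.
  intros F s1 s2 HF Hs. pose proof two_pi_pos.
  pose proof (goursat_rect (fun z => F (cexp z)) s1 s2 0 (2 * PI) ltac:(lra) ltac:(lra)) as G.
  unfold rect_int in G.
  assert (E : CInt (fun x => F (cexp (x, (2 * PI)%R))) s1 s2 = CInt (fun x => F (cexp (x, 0%R))) s1 s2).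
  { apply (RInt_ext (V := C_R_CompleteNormedModule)). intros x _. rewrite cexp_2PI. reflexivity. }
  rewrite E in G.
  assert (G' : Ci * (circle_int F s2 - circle_int F s1) = 0).
  { unfold circle_int. rewrite <- G; [ring|].
    intros x y Hx Hy. apply differentiable_comp_cexp; simpl; auto; lra. }
  assert (G2 : circle_int F s2 - circle_int F s1 = 0).
  { replace (circle_int F s2 - circle_int F s1)
      with (- Ci * (Ci * (circle_int F s2 - circle_int F s1))).
    - rewrite G'. ring.
    - replace (- Ci * (Ci * (circle_int F s2 - circle_int F s1)))
        with (- (Ci * Ci) * (circle_int F s2 - circle_int F s1)) by ring.
      replace (Ci * Ci) with (- RtoC 1) by (unfold Ci, Cmult, Copp, RtoC; simpl; f_equal; ring).
      ring. }
  replace (circle_int F s2) with (circle_int F s2 - circle_int F s1 + circle_int F s1) by ring.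
  rewrite G2. ring.
Qed.

Lemma circle_int_radius_indep : forall F s1 s2, analytic_on_punctured_disc F ->
  (s1 < 0)%R -> (s2 < 0)%R -> circle_int F s1 = circle_int F s2.
Proof.
  intros F s1 s2 HF H1 H2. destruct (Rle_dec s1 s2).
  - apply circle_int_radius_indep_le; auto.
  - symmetry; apply circle_int_radius_indep_le; auto; lra.
Qed.

(** The value at 0 is left out: quotients by powers of [z] have no meaningful
    value there. *)
Definition limit_at_0 (F : C -> C) (L : C) : Prop :=
  forall eps : R, (0 < eps)%R -> exists delta : R, (0 < delta)%R /\
    forall z : C, z <> 0 -> (Cmod z < delta)%R -> (Cmod (F z - L) < eps)%R.

(** The integral does not depend on the radius, and over small circles [F] is
    close to [L]. *)
Lemma circle_int_limit : forall F L s, analytic_on_punctured_disc F -> limit_at_0 F L ->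
  (s < 0)%R -> circle_int F s = RtoC (2 * PI) * L.
Proof.
  intros F L s HF HL Hs. pose proof two_pi_pos as Hpi.
  cut (circle_int F s - RtoC (2 * PI) * L = 0).
  { intros E. replace (circle_int F s) with (circle_int F s - RtoC (2 * PI) * L + RtoC (2 * PI) * L) by ring.
    rewrite E. ring. }
  apply Cmod_eq_0. apply Rle_antisym; [|apply Cmod_ge_0].
  apply Rnot_lt_le; intros Hpos.
  set (P := Cmod (circle_int F s - RtoC (2 * PI) * L)) in *.
  destruct (HL (P / (4 * PI))%R) as [delta [Hdelta Hd]].
  { apply Rdiv_lt_0_compat; lra. }
  (* A logarithmic radius small enough for the circle to lie within [delta]. *)
  set (s' := Rmin (-1) (ln delta - 1)).
  assert (Hs' : (s' < 0)%R) by (unfold s'; pose proof (Rmin_l (-1) (ln delta - 1)); lra).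
  assert (Hs'' : (s' < ln delta)%R) by (unfold s'; pose proof (Rmin_r (-1) (ln delta - 1)); lra).
  assert (B : (Cmod (circle_int F s' - RtoC (2 * PI) * L) <= (2 * PI - 0) * (P / (4 * PI)))%R).
  { apply (CInt_norm_le (fun t => F (cexp (s', t)) - L) 0 (2 * PI)); [lra| |].
    - intros t _. left. apply Hd; [apply cexp_neq_0|].
      rewrite Cmod_cexp; simpl. rewrite <- (exp_ln delta Hdelta). apply exp_increasing; lra.
    - apply is_CInt_minus; [apply circle_int_correct; auto|].
      pose proof (is_CInt_const L 0 (2 * PI)) as K. rewrite Rminus_0_r in K. exact K. }
  rewrite (circle_int_radius_indep F s' s HF Hs' Hs) in B. fold P in B.
  replace ((2 * PI - 0) * (P / (4 * PI)))%R with (P / 2)%R in B by (field; apply PI_neq0).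
  lra.
Qed.

Lemma limit_at_0_pow : forall F L n, limit_at_0 F L -> limit_at_0 (fun z => F z * z ^ S n) 0.
Proof.
  intros F L n HF eps Heps.
  destruct (HF 1%R Rlt_0_1) as [d [Hd H]].
  pose proof (Cmod_ge_0 L) as HL.
  assert (Hq : (0 < eps / (Cmod L + 1))%R) by (apply Rdiv_lt_0_compat; lra).
  exists (Rmin d (Rmin 1 (eps / (Cmod L + 1)))).
  split; [repeat apply Rmin_pos; lra|]. intros z Hz Hzd.
  pose proof (Rmin_l d (Rmin 1 (eps / (Cmod L + 1)))).
  pose proof (Rmin_r d (Rmin 1 (eps / (Cmod L + 1)))).
  pose proof (Rmin_l 1 (eps / (Cmod L + 1))).
  pose proof (Rmin_r 1 (eps / (Cmod L + 1))).
  specialize (H z Hz ltac:(lra)).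
  replace (F z * z ^ S n - 0) with (F z * z ^ S n) by ring.
  rewrite Cmod_mult, Cmod_pow. simpl.
  pose proof (Cmod_ge_0 z) as Hz0.
  pose proof (Cmod_triangle (F z - L) L) as T. replace (F z - L + L) with (F z) in T by ring.
  assert (Hp : (Cmod z ^ n <= 1)%R).
  { rewrite <- (pow1 n). apply pow_incr. lra. }
  pose proof (pow_le _ n Hz0).
  assert (Hl : (Cmod z * (Cmod L + 1) < eps)%R).
  { replace eps with (eps / (Cmod L + 1) * (Cmod L + 1))%R at 1 by (field; lra).
    apply Rmult_lt_compat_r; lra. }
  pose proof (Cmod_ge_0 (F z)).
  apply Rle_lt_trans with ((Cmod L + 1) * (Cmod z * 1))%R; [|lra].
  apply Rmult_le_compat; try lra; [apply Rmult_le_pos; lra|].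
  apply Rmult_le_compat_l; lra.
Qed.

Lemma limit_at_0_differentiable : forall F : C -> C, C_differentiable F (RtoC 0) -> limit_at_0 F (F 0).
Proof.
  intros F HF eps Heps. destruct (ex_derive_C_continuous F (RtoC 0) HF eps Heps) as [d [Hd H]].
  exists d; split; [exact Hd|]. intros z _ Hz. apply H.
  replace (z - 0) with z by ring. exact Hz.
Qed.

Lemma analytic_punctured : forall F, analytic_on_disc F -> analytic_on_punctured_disc F.
Proof. intros F HF z _ Hz. apply HF, Hz. Qed.

Lemma in_disc_0 : in_disc 0.
Proof. unfold in_disc. rewrite Cmod_0. lra. Qed.

(** On a circle centred at 0, inversion is conjugation up to a constant
    factor. *)
Lemma Cinv_cexp_pow : forall s t k,
  / (cexp (s, t) ^ k) = RtoC (/ (exp s ^ k * exp s ^ k)) * Cconj (cexp (s, t) ^ k).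
Proof.
  intros s t k. set (Z := cexp (s, t) ^ k).
  assert (HZ : Cmod Z = (exp s ^ k)%R) by (unfold Z; rewrite Cmod_pow, Cmod_cexp; reflexivity).
  assert (Hr : (0 < exp s ^ k)%R) by apply pow_lt, exp_pos.
  assert (HZ0 : Z <> 0) by (apply Cmod_gt_0; lra).
  pose proof (Cmod2_conj Z) as H. rewrite HZ in H.
  replace (exp s ^ k * exp s ^ k)%R with ((exp s ^ k) ^ 2)%R by ring.
  rewrite RtoC_inv by (apply pow_nonzero; lra). rewrite H.
  field. split; auto.
  intros E. rewrite E in H. rewrite Cmult_0_r in H.
  apply RtoC_inj in H. revert H. apply pow_nonzero; lra.
Qed.

(** The conjugate of the integral of a positive power, which vanishes because
    that power tends to 0 at the origin. *)
Lemma circle_int_pow_inv : forall n s, (s < 0)%R ->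
  is_CInt (fun t => / (cexp (s, t) ^ S n)) 0 (2 * PI) (RtoC 0).
Proof.
  intros n s Hs.
  assert (A1 : analytic_on_punctured_disc (fun z => 1 * z ^ S n)).
  { intros z _ _. apply ex_derive_C_mult; [apply ex_derive_C_const|apply ex_derive_C_pow]. }
  pose proof (circle_int_correct _ s A1 Hs) as I.
  rewrite (circle_int_limit _ 0 s A1) in I; auto.
  2:{ apply (limit_at_0_pow (fun _ => 1) 1). intros e He. exists 1%R; split; [lra|].
      intros z _ _. replace (1 - 1) with (RtoC 0) by ring. rewrite Cmod_0. exact He. }
  pose proof (is_CInt_scal (RtoC (/ (exp s ^ S n * exp s ^ S n))) _ _ _ _ (is_CInt_conj _ _ _ _ I)) as J.
  replace (RtoC (/ (exp s ^ S n * exp s ^ S n)) * Cconj (RtoC (2 * PI) * 0)) with (RtoC 0) in J.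
  2:{ rewrite Cmult_0_r. unfold Cconj, RtoC, Cmult; simpl. f_equal; ring. }
  eapply is_CInt_ext; [|exact J].
  intros t. rewrite Cinv_cexp_pow, Cmult_1_l. reflexivity.
Qed.

(** * Coefficients of functions with positive real part *)

Lemma Re_mult_real : forall (z : C) (x : R), Re (z * RtoC x) = (Re z * x)%R.
Proof. intros [a b] x. unfold Re; simpl. ring. Qed.

Lemma CInt_Re_nonneg : forall (F : R -> C) a b (l : C), (a <= b)%R ->
  (forall t, (0 <= Re (F t))%R) -> is_CInt F a b l -> (0 <= Re l)%R.
Proof.
  intros F a b l Hab HF Hl. apply is_CInt_Re in Hl.
  rewrite <- (is_RInt_unique _ _ _ _ Hl).
  apply RInt_ge_0; auto. eexists; exact Hl.
Qed.

(** The weight against which [p] is integrated below: being a nonnegative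
    real, it preserves the sign of the real part of [p]. *)
Lemma weight_nonneg : forall v : C, (Cmod v <= 1)%R ->
  exists x : R, (0 <= x)%R /\ 2 + v + Cconj v = RtoC x.
Proof.
  intros [a b] Hv. exists (2 + 2 * a)%R. split.
  - pose proof (re_le_Cmod (a, b)) as H. unfold Re in H; simpl in H.
    pose proof (Rle_abs (- a)) as K. rewrite Rabs_Ropp in K. lra.
  - unfold Cconj, Cplus, RtoC; simpl. f_equal; ring.
Qed.

(** Integrate [p] over a circle of radius [r] against the nonnegative weight
    [2 + conj u E^k + u E^-k], where [E] is the unit vector of the circle
    point, [u] has modulus 1 and [k = n + 1]. The real part of the result is
    nonnegative. The three terms contribute the value at 0, nothing (as [p
    z^k] vanishes at 0) and the coefficient [c], so [2 + r^k Re (u c) >= 0];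
    choosing [u] so that [u c = - |c|] and letting [r] tend to 1 gives the
    bound. *)
Lemma caratheodory_coef : forall (p : C -> C) (n : nat) (c : C),
  analytic_on_disc p -> p 0 = 1 -> (forall z, in_disc z -> (0 < Re (p z))%R) ->
  (forall s, (s < 0)%R ->
     is_CInt (fun t => p (cexp (s, t)) * / (cexp (s, t) ^ S n)) 0 (2 * PI)
       (RtoC (2 * PI) * c)) ->
  (Cmod c <= 2)%R.
Proof.
  intros p n c Hp Hp0 HRe Hc. pose proof two_pi_pos as Hpi.
  set (k := S n) in *.
  assert (Key : forall s, (s < 0)%R -> (Cmod c * exp s ^ k <= 2)%R).
  { intros s Hs.
    assert (Hr : (0 < exp s ^ k)%R) by apply pow_lt, exp_pos.
    set (r := (exp s ^ k)%R) in *.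
    destruct (Req_dec (Cmod c) 0) as [E0|N0]; [rewrite E0; lra|].
    assert (Hc0 : (0 < Cmod c)%R) by (pose proof (Cmod_ge_0 c); lra).
    (* The unit number for which [u * c] is the negative real [- Cmod c]. *)
    set (u := - RtoC (/ Cmod c) * Cconj c).
    assert (Hu : u * c = RtoC (- Cmod c)).
    { unfold u. replace (- RtoC (/ Cmod c) * Cconj c * c) with (- RtoC (/ Cmod c) * (c * Cconj c)) by ring.
      rewrite <- Cmod2_conj, <- RtoC_opp, <- RtoC_mult. f_equal. field. exact N0. }
    assert (Hum : Cmod u = 1%R).
    { unfold u. rewrite Cmod_mult, Cmod_opp, Cmod_conj, Cmod_R, Rabs_pos_eq.
      - field. exact N0.
      - left. apply Rinv_0_lt_compat, Hc0. }
    pose proof (circle_int_correct p s (analytic_punctured p Hp) Hs) as I0.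
    rewrite (circle_int_limit p 1 s (analytic_punctured p Hp)) in I0; auto.
    2:{ rewrite <- Hp0. apply limit_at_0_differentiable, Hp, in_disc_0. }
    assert (Ak : analytic_on_punctured_disc (fun z => p z * z ^ k)).
    { intros z _ Hz. apply ex_derive_C_mult; [apply Hp, Hz|apply ex_derive_C_pow]. }
    pose proof (circle_int_correct _ s Ak Hs) as Ik.
    rewrite (circle_int_limit _ 0 s Ak) in Ik; auto.
    2:{ apply (limit_at_0_pow p 1). rewrite <- Hp0.
        apply limit_at_0_differentiable, Hp, in_disc_0. }
    pose proof (Hc s Hs) as Im.
    pose proof (is_CInt_plus _ _ _ _ _ _ (is_CInt_scal 2 _ _ _ _ I0)
                 (is_CInt_plus _ _ _ _ _ _ (is_CInt_scal (Cconj u * RtoC (/ r)) _ _ _ _ Ik)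
                                            (is_CInt_scal (u * RtoC r) _ _ _ _ Im))) as IW.
    apply CInt_Re_nonneg in IW; [|lra|].
    - replace (2 * (RtoC (2 * PI) * 1) + (Cconj u * RtoC (/ r) * (RtoC (2 * PI) * 0) +
        u * RtoC r * (RtoC (2 * PI) * c))) with (RtoC (2 * (2 * PI)) + (u * c) * RtoC (r * (2 * PI))) in IW.
      2:{ rewrite !RtoC_mult. ring. }
      rewrite Hu, <- RtoC_mult, <- RtoC_plus in IW. simpl in IW. nra.
    - intros t.
      pose proof (HRe (cexp (s, t)) (cexp_in_disc s t Hs)) as HR.
      set (Z := cexp (s, t)) in *.
      set (v := Cconj u * RtoC (/ r) * Z ^ k).
      assert (Hv : (Cmod v <= 1)%R).
      { unfold v. rewrite !Cmod_mult, Cmod_conj, Hum, Cmod_R, Cmod_pow. unfold Z. rewrite Cmod_cexp; simpl Re.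
        fold r. rewrite Rabs_pos_eq by (left; apply Rinv_0_lt_compat, Hr).
        right; field. lra. }
      destruct (weight_nonneg v Hv) as [x [Hx Ex]].
      assert (EZ : / (Z ^ k) = RtoC (/ (r * r)) * Cconj (Z ^ k)) by apply Cinv_cexp_pow.
      replace (2 * p Z + (Cconj u * RtoC (/ r) * (p Z * Z ^ k) + u * RtoC r * (p Z * / (Z ^ k))))
        with (p Z * RtoC x).
      + rewrite Re_mult_real. apply Rmult_le_pos; lra.
      + rewrite <- Ex, EZ. unfold v. rewrite !Cmult_conj, Cconj_conj.
        replace (Cconj (RtoC (/ r))) with (RtoC (/ r)) by (unfold Cconj, RtoC; simpl; f_equal; ring).
        replace (RtoC (/ r)) with (RtoC r * RtoC (/ (r * r))) at 2.
        * ring.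
        * rewrite <- RtoC_mult. f_equal. field. lra. }
  apply Rnot_lt_le; intros Hgt.
  (* If [Cmod c = 2 x] with [x > 1], the radius with [r^k = x^(-1/2)] gives
     [2 x^(1/2) <= 2], a contradiction. *)
  set (x := (Cmod c / 2)%R).
  assert (Hx : (1 < x)%R) by (unfold x; lra).
  assert (Hl : (0 < ln x)%R) by (rewrite <- ln_1; apply ln_increasing; lra).
  assert (Hk : (0 < INR k)%R) by (apply lt_0_INR; unfold k; lia).
  assert (Hs : (- (ln x / (2 * INR k)) < 0)%R).
  { assert (0 < ln x / (2 * INR k))%R by (apply Rdiv_lt_0_compat; lra). lra. }
  specialize (Key _ Hs).
  assert (E : (exp (- (ln x / (2 * INR k))) ^ k = exp (- (ln x / 2)))%R).
  { rewrite <- Rpower_pow by apply exp_pos. unfold Rpower. rewrite ln_exp. f_equal. field. lra. }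
  rewrite E in Key.
  replace (Cmod c) with (2 * exp (ln x))%R in Key by (rewrite exp_ln by lra; unfold x; field).
  rewrite Rmult_assoc, <- exp_plus in Key.
  replace (ln x + - (ln x / 2))%R with (ln x / 2)%R in Key by field.
  pose proof (exp_ineq1 (ln x / 2) ltac:(lra)). lra.
Qed.

(** * Second-order jets at the origin *)

(** Unlike [limit_at_0], the point 0 itself is included. This forces the value
    of [F] at 0, but makes composition with a function vanishing at 0 free of
    side conditions. *)
Definition continuous_value_at_0 (F : C -> C) (L : C) : Prop :=
  forall eps : R, (0 < eps)%R -> exists delta : R, (0 < delta)%R /\
    forall z : C, (Cmod z < delta)%R -> (Cmod (F z - L) < eps)%R.

Definition near_0 (P : C -> Prop) : Prop :=
  exists delta : R, (0 < delta)%R /\ forall z : C, (Cmod z < delta)%R -> P z.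

Lemma near_0_and : forall P Q : C -> Prop, near_0 P -> near_0 Q -> near_0 (fun z => P z /\ Q z).
Proof.
  intros P Q [d [Hd H]] [e [He K]]. exists (Rmin d e); split; [apply Rmin_pos; auto|].
  intros z Hz. pose proof (Rmin_l d e). pose proof (Rmin_r d e). split; [apply H|apply K]; lra.
Qed.

Lemma near_0_imp : forall P Q : C -> Prop, (forall z, P z -> Q z) -> near_0 P -> near_0 Q.
Proof. intros P Q H [d [Hd K]]. exists d; split; auto. Qed.

Lemma near_0_in_disc : near_0 in_disc.
Proof. exists 1%R; split; [lra|auto]. Qed.

Lemma cv0_const : forall c : C, continuous_value_at_0 (fun _ => c) c.
Proof.
  intros c eps He. exists 1%R; split; [lra|]. intros z _.
  replace (c - c) with (RtoC 0) by ring. rewrite Cmod_0. exact He.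
Qed.

Lemma cv0_id : continuous_value_at_0 (fun z => z) 0.
Proof.
  intros eps He. exists eps; split; [exact He|]. intros z Hz.
  replace (z - 0) with z by ring. exact Hz.
Qed.

Lemma cv0_plus : forall F G L M, continuous_value_at_0 F L -> continuous_value_at_0 G M ->
  continuous_value_at_0 (fun z => F z + G z) (L + M).
Proof.
  intros F G L M HF HG eps He.
  eapply near_0_imp; [|apply (near_0_and _ _ (HF (eps / 2)%R ltac:(lra)) (HG (eps / 2)%R ltac:(lra)))].
  intros z [H1 H2]. simpl in *.
  replace (F z + G z - (L + M)) with ((F z - L) + (G z - M)) by ring.
  eapply Rle_lt_trans; [apply Cmod_triangle|lra].
Qed.

Lemma cv0_mult : forall F G L M, continuous_value_at_0 F L -> continuous_value_at_0 G M ->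
  continuous_value_at_0 (fun z => F z * G z) (L * M).
Proof.
  intros F G L M HF HG eps He.
  pose proof (Cmod_ge_0 L) as HL. pose proof (Cmod_ge_0 M) as HM.
  set (e := Rmin 1 (eps / (Cmod L + Cmod M + 1))).
  assert (Hq : (0 < eps / (Cmod L + Cmod M + 1))%R) by (apply Rdiv_lt_0_compat; lra).
  assert (He0 : (0 < e)%R) by (apply Rmin_pos; lra).
  assert (He1 : (e <= 1)%R) by apply Rmin_l.
  assert (He2 : (e * (Cmod L + Cmod M + 1) <= eps)%R).
  { replace eps with (eps / (Cmod L + Cmod M + 1) * (Cmod L + Cmod M + 1))%R at 1 by (field; lra).
    apply Rmult_le_compat_r; [lra|apply Rmin_r]. }
  eapply near_0_imp; [|apply (near_0_and _ _ (HF e He0) (HG e He0))].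
  intros z [H1 H2]. simpl in *.
  replace (F z * G z - L * M) with ((F z - L) * (G z - M) + ((F z - L) * M + L * (G z - M))) by ring.
  eapply Rle_lt_trans; [apply Cmod_triangle|].
  eapply Rle_lt_trans; [apply Rplus_le_compat_l, Cmod_triangle|].
  rewrite !Cmod_mult.
  pose proof (Cmod_ge_0 (F z - L)). pose proof (Cmod_ge_0 (G z - M)).
  nra.
Qed.

Lemma cv0_inv : forall F L, continuous_value_at_0 F L -> L <> 0 ->
  continuous_value_at_0 (fun z => / F z) (/ L).
Proof.
  intros F L HF HL eps He.
  destruct (ex_derive_C_continuous (fun x => / x) L) with (eps := eps) as [d [Hd H]]; [|exact He|].
  - eexists; apply is_derive_C_inv, HL.
  - eapply near_0_imp; [|exact (HF d Hd)]. intros z Hz. apply (H (F z) Hz).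
Qed.

Lemma cv0_comp : forall F h L, continuous_value_at_0 F L -> continuous_value_at_0 h 0 ->
  continuous_value_at_0 (fun z => F (h z)) L.
Proof.
  intros F h L HF Hh eps He. destruct (HF eps He) as [d [Hd H]].
  eapply near_0_imp; [|exact (Hh d Hd)]. intros z Hz. apply H. cbv beta in Hz.
  replace (h z - 0) with (h z) in Hz by ring. exact Hz.
Qed.

Lemma near_0_comp : forall (P : C -> Prop) h, near_0 P -> continuous_value_at_0 h 0 ->
  near_0 (fun z => P (h z)).
Proof.
  intros P h [d [Hd H]] Hh.
  eapply near_0_imp; [|exact (Hh d Hd)]. intros z Hz. apply H. cbv beta in Hz.
  replace (h z - 0) with (h z) in Hz by ring. exact Hz.
Qed.

Lemma cv0_ext : forall F G L, near_0 (fun z => F z = G z) ->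
  continuous_value_at_0 F L -> continuous_value_at_0 G L.
Proof.
  intros F G L H HF eps He.
  eapply near_0_imp; [|apply (near_0_and _ _ H (HF eps He))]. simpl.
  intros z [E K]. rewrite <- E. exact K.
Qed.

Lemma near_0_exists_neq : forall P, near_0 P -> exists z : C, z <> 0 /\ P z.
Proof.
  intros P [d [Hd H]]. exists (RtoC (d / 2)). split.
  - intros E. apply RtoC_inj in E. lra.
  - apply H. rewrite Cmod_R, Rabs_pos_eq; lra.
Qed.

(** A function continuous at 0 is determined there by its values at nearby
    nonzero points; this identifies coefficients. *)
Lemma cv0_punctured_zero : forall F L, continuous_value_at_0 F L ->
  near_0 (fun z => z <> 0 -> F z = 0) -> L = 0.
Proof.
  intros F L HF Hz. apply Cmod_eq_0. apply Rle_antisym; [|apply Cmod_ge_0].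
  apply Rnot_lt_le; intros Hpos.
  destruct (near_0_exists_neq _ (near_0_and _ _ Hz (HF _ Hpos))) as [z [Hz0 [E K]]].
  rewrite (E Hz0) in K. replace (0 - L) with (- L) in K by ring. rewrite Cmod_opp in K. lra.
Qed.

Lemma cv0_neq_0 : forall F L, continuous_value_at_0 F L -> L <> 0 -> near_0 (fun z => F z <> 0).
Proof.
  intros F L HF HL. eapply near_0_imp; [|apply (HF (Cmod L))].
  - cbv beta. intros z Hz E. rewrite E in Hz. replace (0 - L) with (- L) in Hz by ring.
    rewrite Cmod_opp in Hz. lra.
  - apply Cmod_gt_0, HL.
Qed.

(** Expansion to order 2 with the remainder absorbed in a coefficient [E] that
    varies continuously at 0, so that computing with jets is ring algebra
    followed by the limit rules. *)
Definition jet2 (F : C -> C) (c0 c1 c2 : C) : Prop :=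
  exists E, continuous_value_at_0 E c2 /\
    near_0 (fun z => F z = c0 + c1 * z + z * z * E z).

Lemma jet2_cv0 : forall F c0 c1 c2, jet2 F c0 c1 c2 -> continuous_value_at_0 F c0.
Proof.
  intros F c0 c1 c2 [E [HE H]].
  replace c0 with (c0 + c1 * 0 + 0 * 0 * c2) by ring.
  eapply cv0_ext; [eapply near_0_imp; [|exact H]; intros z Hz; symmetry; exact Hz|].
  repeat first [apply cv0_plus | apply cv0_mult | apply cv0_const | apply cv0_id | exact HE].
Qed.

Lemma jet2_ext : forall F G c0 c1 c2, near_0 (fun z => F z = G z) ->
  jet2 F c0 c1 c2 -> jet2 G c0 c1 c2.
Proof.
  intros F G c0 c1 c2 H [E [HE K]]. exists E; split; [exact HE|].
  eapply near_0_imp; [|apply (near_0_and _ _ H K)]. simpl. intros z [<- Hz]. exact Hz.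
Qed.

Lemma jet2_coef : forall F c0 c1 c2 d0 d1 d2, jet2 F c0 c1 c2 ->
  c0 = d0 -> c1 = d1 -> c2 = d2 -> jet2 F d0 d1 d2.
Proof. intros; subst; assumption. Qed.

Lemma jet2_affine : forall c0 c1 : C, jet2 (fun z => c0 + c1 * z) c0 c1 0.
Proof.
  intros c0 c1. exists (fun _ => 0). split; [apply cv0_const|].
  exists 1%R; split; [lra|]. intros z _. ring.
Qed.

Lemma jet2_mult : forall F G c0 c1 c2 d0 d1 d2, jet2 F c0 c1 c2 -> jet2 G d0 d1 d2 ->
  jet2 (fun z => F z * G z) (c0 * d0) (c0 * d1 + c1 * d0) (c0 * d2 + c1 * d1 + c2 * d0).
Proof.
  intros F G c0 c1 c2 d0 d1 d2 [E [HE H]] [D [HD K]].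
  exists (fun z => c0 * D z + c1 * d1 + E z * d0 + z * (c1 * D z + E z * d1) + z * z * (E z * D z)).
  split.
  - replace (c0 * d2 + c1 * d1 + c2 * d0)
      with (c0 * d2 + c1 * d1 + c2 * d0 + 0 * (c1 * d2 + c2 * d1) + 0 * 0 * (c2 * d2)) by ring.
    repeat first [apply cv0_const | apply cv0_id | exact HE | exact HD | apply cv0_plus | apply cv0_mult].
  - eapply near_0_imp; [|apply (near_0_and _ _ H K)]. simpl. intros z [-> ->]. ring.
Qed.

Lemma jet2_inv : forall F c1 c2, jet2 F 1 c1 c2 ->
  jet2 (fun z => / F z) 1 (- c1) (c1 * c1 - c2).
Proof.
  intros F c1 c2 HF. pose proof (jet2_cv0 _ _ _ _ HF) as HF0.
  assert (H1 : (1 : C) <> 0) by (intros E; apply RtoC_inj in E; lra).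
  destruct HF as [E [HE H]].
  exists (fun z => (c1 * c1 + (-1) * E z + z * (c1 * E z)) * / F z). split.
  - replace (c1 * c1 - c2) with ((c1 * c1 + (-1) * c2 + 0 * (c1 * c2)) * / 1) by (field; exact H1).
    repeat first [apply cv0_const | apply cv0_id | exact HE
                 | apply cv0_inv; [exact HF0|exact H1] | apply cv0_plus | apply cv0_mult].
  - eapply near_0_imp; [|apply (near_0_and _ _ H (cv0_neq_0 _ _ HF0 H1))]. simpl.
    intros z [Hz Hn]. rewrite Hz in *. field. exact Hn.
Qed.

Lemma jet2_comp : forall F h c0 c1 c2 h1 h2, jet2 F c0 c1 c2 -> jet2 h 0 h1 h2 ->
  jet2 (fun z => F (h z)) c0 (c1 * h1) (c1 * h2 + h1 * h1 * c2).
Proof.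
  intros F h c0 c1 c2 h1 h2 [E [HE H]] Hh. pose proof (jet2_cv0 _ _ _ _ Hh) as Hh0.
  destruct Hh as [D [HD K]].
  exists (fun z => c1 * D z + (h1 + z * D z) * (h1 + z * D z) * E (h z)). split.
  - replace (c1 * h2 + h1 * h1 * c2)
      with (c1 * h2 + (h1 + 0 * h2) * (h1 + 0 * h2) * c2) by ring.
    repeat first [apply cv0_const | apply cv0_id | exact HD
                 | apply (cv0_comp E h c2 HE Hh0) | apply cv0_plus | apply cv0_mult].
  - eapply near_0_imp; [|apply (near_0_and _ _ (near_0_comp _ _ H Hh0) K)]. simpl.
    intros z [-> Hz]. rewrite Hz at 1 2 3. ring.
Qed.

(** The difference quotient at 0, extended by the derivative. *)
Lemma derivative_slope : forall (h : C -> C) (l : C), h 0 = 0 ->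
  @is_derive C_AbsRing C_NormedModule h (RtoC 0) l ->
  exists k, continuous_value_at_0 k l /\ forall z, h z = z * k z.
Proof.
  intros h l H0 Hd. exists (fun z => if Ceq_dec z 0 then l else h z / z). split.
  - intros eps He.
    destruct (proj1 (is_derive_C_iff _ _ _) Hd (eps / 2)%R ltac:(lra)) as [d [Hd0 H]].
    exists d; split; [exact Hd0|]. intros z Hz.
    destruct (Ceq_dec z 0) as [E|N].
    + replace (l - l) with (RtoC 0) by ring. rewrite Cmod_0. exact He.
    + specialize (H z). rewrite H0 in H. replace (z - 0) with z in H by ring.
      specialize (H Hz). replace (h z - 0 - l * z) with (z * (h z / z - l)) in H by (field; exact N).
      rewrite Cmod_mult in H. pose proof (proj1 (Cmod_gt_0 z) N) as Hp.
      apply Rle_lt_trans with (eps / 2)%R; [|lra].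
      apply (Rmult_le_reg_l (Cmod z)); lra.
  - intros z. destruct (Ceq_dec z 0) as [->|N]; [rewrite H0; ring|field; exact N].
Qed.

(** Implicit second-order expansion: the jets of [F] and of [F o h] determine
    that of [h] when the linear coefficient of [F] is invertible. It serves
    twice, for the inverse function ([F o h] is the identity near 0) and for
    the Schwarz function of a subordination. *)
Lemma jet2_solve : forall (F h : C -> C) (c0 b1 b2 d1 d2 : C), jet2 F c0 b1 b2 -> b1 <> 0 ->
  C_differentiable h (RtoC 0) -> h 0 = 0 -> jet2 (fun z => F (h z)) c0 d1 d2 ->
  jet2 h 0 (d1 / b1) ((d2 - (d1 / b1) * (d1 / b1) * b2) / b1).
Proof.
  intros F h c0 b1 b2 d1 d2 [E [HE H]] Hb Hd Hh0 [D [HD K]].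
  assert (Hex : exists l : C, @is_derive C_AbsRing C_NormedModule h (RtoC 0) l) by exact Hd.
  destruct Hex as [l Hl].
  destruct (derivative_slope h l Hh0 Hl) as [k [Hk Hhk]].
  assert (Hh : continuous_value_at_0 h 0).
  { apply (cv0_ext (fun z => z * k z)); [exists 1%R; split; [lra|intros z _; symmetry; apply Hhk]|].
    replace (RtoC 0) with (0 * l) by ring. apply cv0_mult; [apply cv0_id|exact Hk]. }
  set (G := fun z => (D z + (-1) * (k z * k z * E (h z))) * / b1).
  assert (HG : continuous_value_at_0 G ((d2 + (-1) * (l * l * b2)) * / b1)).
  { unfold G. repeat first [apply cv0_const | exact HD | exact Hk
                 | apply (cv0_comp E h b2 HE Hh) | apply cv0_plus | apply cv0_mult]. }
  assert (Eq : near_0 (fun z => h z = 0 + d1 / b1 * z + z * z * G z)).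
  { eapply near_0_imp; [|apply (near_0_and _ _ (near_0_comp _ _ H Hh) K)]. simpl.
    intros z [E1 E2]. rewrite E1 in E2.
    assert (E3 : b1 * h z = d1 * z + z * z * (D z - k z * k z * E (h z))).
    { rewrite (Hhk z) in E2 at 1 2 3. rewrite (Hhk z) at 1.
      replace (b1 * (z * k z)) with (c0 + b1 * (z * k z) + z * k z * (z * k z) * E (h z)
         - c0 - z * k z * (z * k z) * E (h z)) by ring.
      rewrite E2. ring. }
    replace (h z) with (/ b1 * (b1 * h z)) by (field; exact Hb).
    rewrite E3. unfold G. field. exact Hb. }
  (* For [z <> 0] the slope [k z] is [d1 / b1 + z * G z], and both are
     continuous at 0. *)
  assert (El : l = d1 / b1).
  { assert (Z : l + (-1) * (d1 / b1 + 0 * ((d2 + (-1) * (l * l * b2)) * / b1)) = 0).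
    { apply (cv0_punctured_zero (fun z => k z + (-1) * (d1 / b1 + z * G z))).
      - repeat first [apply cv0_const | apply cv0_id | exact HG | exact Hk
                 | apply cv0_plus | apply cv0_mult].
      - eapply near_0_imp; [|exact Eq]. simpl. intros z Hz Hz0.
        rewrite Hhk in Hz.
        replace (k z) with (/ z * (z * k z)) by (field; exact Hz0).
        rewrite Hz. field. auto. }
    replace l with (l + (-1) * (d1 / b1 + 0 * ((d2 + (-1) * (l * l * b2)) * / b1)) + d1 / b1) at 1
      by (field; exact Hb).
    rewrite Z. ring. }
  exists G. split; [|exact Eq].
  replace ((d2 - d1 / b1 * (d1 / b1) * b2) / b1) with ((d2 + -1 * (l * l * b2)) * / b1); [exact HG|].
  rewrite El. field. exact Hb.
Qed.

(** * First two coefficients of Caratheodory and Schwarz functions *)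

Lemma limit_at_0_cv0 : forall F G L, continuous_value_at_0 F L ->
  near_0 (fun z => z <> 0 -> G z = F z) -> limit_at_0 G L.
Proof.
  intros F G L HF HG eps He.
  destruct (near_0_and _ _ HG (HF eps He)) as [d [Hd H]].
  exists d; split; [exact Hd|]. intros z Hz0 Hz. destruct (H z Hz) as [E K].
  rewrite (E Hz0). exact K.
Qed.

(** The integrals of [p / z] and [p / z^2] over circles isolate the first two
    coefficients: subtracting the lower-order terms leaves functions with a
    limit at 0, and the subtracted negative powers integrate to 0. *)
Lemma caratheodory : forall (p : C -> C) (p1 p2 : C),
  analytic_on_disc p -> p 0 = 1 -> (forall z, in_disc z -> (0 < Re (p z))%R) ->
  jet2 p 1 p1 p2 -> (Cmod p1 <= 2 /\ Cmod p2 <= 2)%R.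
Proof.
  intros p p1 p2 Hp Hp0 HRe [E [HE HJ]].
  assert (Dinv : forall n (z : C), z <> 0 -> C_differentiable (fun z => / z ^ n) z).
  { intros n z Hz. apply (ex_derive_C_inv (fun z => z ^ n)); [apply ex_derive_C_pow|].
    apply Cpow_nz, Hz. }
  split.
  - apply (caratheodory_coef p 0 p1 Hp Hp0 HRe). intros s Hs.
    set (q := fun z => (p z + -1 * 1) * / z ^ 1).
    assert (Aq : analytic_on_punctured_disc q).
    { intros z Hz0 Hz. apply ex_derive_C_mult; [|apply Dinv, Hz0].
      apply ex_derive_C_plus; [apply Hp, Hz|apply ex_derive_C_const]. }
    assert (Lq : limit_at_0 q p1).
    { apply (limit_at_0_cv0 (fun z => p1 + z * E z)).
      - assert (K : continuous_value_at_0 (fun z => p1 + z * E z) (p1 + 0 * p2)).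
        { repeat first [apply cv0_const | apply cv0_id | exact HE | apply cv0_plus | apply cv0_mult]. }
        replace (p1 + 0 * p2) with p1 in K by ring. exact K.
      - eapply near_0_imp; [|exact HJ]. simpl. intros z Hz Hz0. unfold q. rewrite Hz.
        simpl. field. exact Hz0. }
    pose proof (circle_int_correct q s Aq Hs) as Iq.
    rewrite (circle_int_limit q p1 s Aq Lq Hs) in Iq.
    pose proof (is_CInt_plus _ _ _ _ _ _ Iq (circle_int_pow_inv 0 s Hs)) as I.
    rewrite Cplus_0_r in I.
    eapply is_CInt_ext; [|exact I]. intros t. unfold q. ring.
  - apply (caratheodory_coef p 1 p2 Hp Hp0 HRe). intros s Hs.
    set (q := fun z => (p z + -1 * (1 + p1 * z)) * / z ^ 2).
    assert (Aq : analytic_on_punctured_disc q).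
    { intros z Hz0 Hz. apply ex_derive_C_mult; [|apply Dinv, Hz0].
      apply ex_derive_C_plus; [apply Hp, Hz|].
      apply ex_derive_C_mult; [apply ex_derive_C_const|apply ex_derive_C_affine]. }
    assert (Lq : limit_at_0 q p2).
    { apply (limit_at_0_cv0 E); [exact HE|].
      eapply near_0_imp; [|exact HJ]. simpl. intros z Hz Hz0. unfold q. rewrite Hz.
      simpl. field. exact Hz0. }
    pose proof (circle_int_correct q s Aq Hs) as Iq.
    rewrite (circle_int_limit q p2 s Aq Lq Hs) in Iq.
    pose proof (is_CInt_plus _ _ _ _ _ _ Iq
                 (is_CInt_plus _ _ _ _ _ _ (circle_int_pow_inv 1 s Hs)
                    (is_CInt_scal p1 _ _ _ _ (circle_int_pow_inv 0 s Hs)))) as I.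
    rewrite Cmult_0_r, !Cplus_0_r in I.
    eapply is_CInt_ext; [|exact I]. intros t. unfold q.
    pose proof (cexp_neq_0 (s, t)) as HZ. simpl. field. exact HZ.
Qed.

(** The real part is [(1 - |w|^2) / |1 - w|^2]. *)
Lemma Re_cayley_pos : forall w : C, (Cmod w < 1)%R -> (0 < Re ((1 + w) * / (1 - w)))%R.
Proof.
  intros w Hw.
  assert (Hn : 1 - w <> 0).
  { intros E. replace w with (1 - (1 - w)) in Hw by ring. rewrite E in Hw.
    replace (1 - 0) with (RtoC 1) in Hw by ring. rewrite Cmod_1 in Hw. lra. }
  pose proof (proj1 (Cmod_gt_0 _) Hn) as Hp.
  set (N := (Cmod (1 - w) ^ 2)%R).
  assert (HN : (0 < N)%R) by (apply pow_lt, Hp).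
  assert (E : (1 + w) * / (1 - w) = (1 + w) * Cconj (1 - w) * RtoC (/ N)).
  { rewrite RtoC_inv by lra. unfold N. rewrite Cmod2_conj. field. split; [|exact Hn].
    intros E. assert (K : RtoC N = 0) by (unfold N; rewrite Cmod2_conj, E; ring).
    apply RtoC_inj in K. lra. }
  rewrite E, Re_mult_real. apply Rmult_lt_0_compat; [|apply Rinv_0_lt_compat, HN].
  pose proof (Cmod2_alt w) as K. pose proof (Cmod_ge_0 w).
  destruct w as [a b]. unfold Re, Im in *; simpl in *. nra.
Qed.

(** The Cayley transform [(1 + w) / (1 - w)] is a Caratheodory function with
    coefficients [2 u1] and [2 (u2 + u1^2)]. *)
Lemma schwarz_coefficients : forall (w : C -> C) (u1 u2 : C),
  analytic_on_disc w -> maps_disc_to_disc w -> w 0 = 0 -> jet2 w 0 u1 u2 ->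
  (Cmod u1 <= 1 /\ Cmod (u2 + u1 * u1) <= 1)%R.
Proof.
  intros w u1 u2 Hw Hmap Hw0 HJ.
  assert (Hn : forall z, in_disc z -> 1 + -1 * w z <> 0).
  { intros z Hz E. specialize (Hmap z Hz). unfold in_disc in Hmap.
    replace (w z) with (1 - (1 + -1 * w z)) in Hmap by ring. rewrite E in Hmap.
    replace (1 - 0) with (RtoC 1) in Hmap by ring. rewrite Cmod_1 in Hmap. lra. }
  destruct (caratheodory (fun z => (1 + w z) * / (1 + -1 * w z)) (2 * u1) (2 * (u2 + u1 * u1)))
    as [B1 B2].
  - intros z Hz. apply ex_derive_C_mult.
    + apply ex_derive_C_plus; [apply ex_derive_C_const|apply Hw, Hz].
    + apply ex_derive_C_inv; [|apply Hn, Hz].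
      apply ex_derive_C_plus; [apply ex_derive_C_const|].
      apply ex_derive_C_mult; [apply ex_derive_C_const|apply Hw, Hz].
  - rewrite Hw0. field.
  - intros z Hz. replace (1 + -1 * w z) with (1 - w z) by ring. apply Re_cayley_pos, Hmap, Hz.
  - pose proof (jet2_comp _ w _ _ _ _ _ (jet2_affine 1 1) HJ) as J1.
    pose proof (jet2_comp _ w _ _ _ _ _ (jet2_affine 1 (-1)) HJ) as J2.
    pose proof (jet2_mult _ _ _ _ _ _ _ _ J1 (jet2_inv _ _ _ J2)) as J3.
    eapply jet2_ext; [|apply (jet2_coef _ _ _ _ _ _ _ J3); ring].
    exists 1%R; split; [lra|]. intros z _. rewrite (Cmult_1_l (w z)). reflexivity.
  - rewrite Cmod_mult, Cmod_R, Rabs_pos_eq in B1, B2 by lra. lra.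
Qed.

Notation is_C_series b l := (@is_series C_AbsRing C_NormedModule b l).
Notation C_sum b n := (@sum_n C_NormedModule b n).

(** * Taylor series near the origin *)

Lemma is_C_series_approx : forall (b : nat -> C) (l : C), is_C_series b l ->
  forall eps : R, (0 < eps)%R -> exists N, forall n, (N <= n)%nat ->
    (Cmod (C_sum b n - l) < eps)%R.
Proof.
  intros b l H eps He.
  destruct (proj1 (filterlim_locally_ball_norm (U := C_NormedModule) _ _) H (mkposreal eps He)) as [N HN].
  exists N. intros n Hn. exact (HN n Hn).
Qed.

Lemma bounded_from_tail : forall (b : nat -> C) (M : R) N, (forall n, (N <= n)%nat -> (Cmod (b n) <= M)%R) ->
  exists M', (0 < M')%R /\ forall n, (Cmod (b n) <= M')%R.
Proof.
  intros b M N. revert M. induction N as [|N IH]; intros M H.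
  - exists (Rmax M 1). split; [pose proof (Rmax_r M 1); lra|].
    intros n. eapply Rle_trans; [apply H; lia|apply Rmax_l].
  - apply (IH (Rmax M (Cmod (b N)))). intros n Hn.
    destruct (Nat.eq_dec n N) as [->|Hne]; [apply Rmax_r|].
    eapply Rle_trans; [apply H; lia|apply Rmax_l].
Qed.

Lemma C_series_terms_bounded : forall (b : nat -> C) (l : C), is_C_series b l ->
  exists M, (0 < M)%R /\ forall n, (Cmod (b n) <= M)%R.
Proof.
  intros b l H. destruct (is_C_series_approx b l H 1%R Rlt_0_1) as [N HN].
  apply (bounded_from_tail b 2 (S N)). intros [|n] Hn; [lia|].
  pose proof (HN n ltac:(lia)) as H1. pose proof (HN (S n) ltac:(lia)) as H2.
  rewrite sum_Sn in H2. change (Cmod (C_sum b n + b (S n) - l) < 1)%R in H2.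
  replace (b (S n)) with ((C_sum b n + b (S n) - l) - (C_sum b n - l)) by ring.
  eapply Rle_trans; [apply Cmod_triangle_minus|lra].
Qed.

(** Comparison with the geometric series of ratio 1/2, through partial sums.
    *)
Lemma C_series_geometric_bound : forall (b : nat -> C) (l : C) (K : R), is_C_series b l ->
  (forall k, (Cmod (b k) <= K * (1 / 2) ^ k)%R) -> (Cmod l <= 2 * K)%R.
Proof.
  intros b l K H HK.
  assert (HS : forall n, (Cmod (C_sum b n) <= K * (2 - (1 / 2) ^ n))%R).
  { induction n as [|n IH].
    - rewrite sum_O. pose proof (HK O) as H0. simpl in *. lra.
    - rewrite sum_Sn. eapply Rle_trans; [exact (Cmod_triangle (C_sum b n) (b (S n)))|].
      pose proof (HK (S n)) as H1. simpl in *. lra. }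
  assert (K0 : (0 <= K)%R) by (pose proof (HK O) as H0; pose proof (Cmod_ge_0 (b O)); simpl in H0; lra).
  apply Rnot_lt_le; intros Hlt.
  destruct (is_C_series_approx b l H (Cmod l - 2 * K)%R ltac:(lra)) as [N HN].
  specialize (HN N (le_n N)). specialize (HS N).
  pose proof (Cmod_minus_ge l (C_sum b N)) as T.
  assert (0 < (1 / 2) ^ N)%R by (apply pow_lt; lra). nra.
Qed.

Lemma pow_n_C : forall (z : C) n, @pow_n C_AbsRing z n = z ^ n.
Proof. intros z n. induction n as [|n IH]; [reflexivity|]. simpl. rewrite IH. reflexivity. Qed.

Lemma taylor_C_series : forall f a z, taylor_expansion f a -> in_disc z ->
  is_C_series (fun k => z ^ k * a k) (f z).
Proof.
  intros f a z H Hz.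
  apply (is_series_ext (K := C_AbsRing) (V := C_NormedModule) (fun k => scal (pow_n (z : C_AbsRing) k) (a k))).
  - intros n. change (@eq C (@pow_n C_AbsRing z n * a n) (z ^ n * a n)).
    rewrite pow_n_C. reflexivity.
  - apply H, Hz.
Qed.

Lemma taylor_coef_0 : forall f a, taylor_expansion f a -> a 0%nat = f 0.
Proof.
  intros f a H.
  pose proof (H 0 in_disc_0) as H1.
  pose proof (is_pseries_0 (K := C_AbsRing) (V := C_NormedModule) a) as H2.
  apply (filterlim_locally_unique (V := C_NormedModule) _ _ _ H2 H1).
Qed.

(** The terms of the series at the point 1/2 are bounded. *)
Lemma taylor_coef_bound : forall f a, taylor_expansion f a ->
  exists M, (0 < M)%R /\ forall n, (Cmod (a n) <= M * 2 ^ n)%R.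
Proof.
  intros f a H.
  assert (Hin : in_disc (RtoC (/ 2))).
  { unfold in_disc. rewrite Cmod_R, Rabs_pos_eq; lra. }
  destruct (C_series_terms_bounded _ _ (taylor_C_series f a _ H Hin)) as [M [HM Hb]].
  exists M; split; [exact HM|]. intros n. specialize (Hb n).
  rewrite Cmod_mult, Cmod_pow, Cmod_R, Rabs_pos_eq in Hb by lra.
  assert (Hp : (0 < 2 ^ n)%R) by (apply pow_lt; lra).
  rewrite pow_inv in Hb.
  apply (Rmult_le_compat_r (2 ^ n)) in Hb; [|lra].
  replace (/ 2 ^ n * Cmod (a n) * 2 ^ n)%R with (Cmod (a n)) in Hb by (field; lra).
  exact Hb.
Qed.

Lemma Cpow_diff_bound : forall (z y : C) (rho : R) n, (Cmod z <= rho)%R -> (Cmod y <= rho)%R ->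
  (Cmod (z ^ S n - y ^ S n) <= INR (S n) * rho ^ n * Cmod (z - y))%R.
Proof.
  intros z y rho n Hz Hy. pose proof (Cmod_ge_0 z) as Hz0.
  induction n as [|n IH].
  - simpl. replace (z * 1 - y * 1) with (z - y) by ring. lra.
  - rewrite (Cpow_S z), (Cpow_S y).
    replace (z * z ^ S n - y * y ^ S n) with (z * (z ^ S n - y ^ S n) + y ^ S n * (z - y)) by ring.
    eapply Rle_trans; [apply Cmod_triangle|]. rewrite !Cmod_mult, Cmod_pow.
    rewrite (S_INR (S n)).
    assert (Hp : (Cmod y ^ S n <= rho ^ S n)%R) by (apply pow_incr; pose proof (Cmod_ge_0 y); lra).
    pose proof (Cmod_ge_0 (z - y)) as Hd.
    assert (H1 : (Cmod z * Cmod (z ^ S n - y ^ S n) <= rho * (INR (S n) * rho ^ n * Cmod (z - y)))%R).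
    { apply Rmult_le_compat; auto using Cmod_ge_0. }
    assert (H2 : (Cmod y ^ S n * Cmod (z - y) <= rho ^ S n * Cmod (z - y))%R)
      by (apply Rmult_le_compat_r; auto).
    replace ((INR (S n) + 1) * rho ^ S n * Cmod (z - y))%R
      with (rho * (INR (S n) * rho ^ n * Cmod (z - y)) + rho ^ S n * Cmod (z - y))%R
      by (simpl; ring).
    lra.
Qed.

Definition cubic (a : nat -> C) (z : C) : C :=
  a 0%nat + z * (a 1%nat + z * (a 2%nat + z * a 3%nat)).

Lemma INR_le_pow2 : forall n, (INR n <= 2 ^ n)%R.
Proof.
  induction n as [|n IH]; [simpl; lra|]. rewrite S_INR. simpl.
  assert (1 <= 2 ^ n)%R by (apply pow_R1_Rle; lra). lra.
Qed.

Lemma taylor_tail_series : forall f a z, taylor_expansion f a -> in_disc z ->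
  is_C_series (fun k => z ^ (4 + k) * a (4 + k)%nat) (f z - cubic a z).
Proof.
  intros f a z H Hz.
  apply (is_series_incr_n (K := C_AbsRing) (V := C_NormedModule) (fun k => z ^ k * a k) 4); [lia|].
  match goal with |- is_series _ ?l => replace l with (f z : C_NormedModule) end.
  - apply taylor_C_series; assumption.
  - simpl. rewrite !sum_Sn, sum_O.
    change (@eq C (f z) (f z - cubic a z + (z ^ 0 * a 0%nat + z ^ 1 * a 1%nat + z ^ 2 * a 2%nat + z ^ 3 * a 3%nat))).
    unfold cubic. simpl. ring.
Qed.

(** Termwise, [z^n - y^n] is bounded by [n rho^(n-1) |z - y|], and the series
    of these bounds converges geometrically for small [rho]. A Lipschitz bound
    on the tail, rather than a mere size bound, is what controls the
    derivative of the tail without differentiating the series term by term. *)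
Lemma taylor_tail_lipschitz : forall f a, taylor_expansion f a ->
  exists K, (0 < K)%R /\ forall (rho : R) (z y : C), (rho <= 1 / 8)%R ->
    (Cmod z <= rho)%R -> (Cmod y <= rho)%R ->
    (Cmod ((f z - cubic a z) - (f y - cubic a y)) <= K * rho ^ 3 * Cmod (z - y))%R.
Proof.
  intros f a H. destruct (taylor_coef_bound f a H) as [M [HM Ha]].
  (* [256 = 4^4]: the coefficient bound [M 2^n] and [n <= 2^n] combine to
     [M 4^n rho^(n-1)], whose first term has [n = 4]; the 2 sums the geometric
     series of ratio [4 rho <= 1/2]. *)
  exists (2 * (M * 256))%R; split; [lra|]. intros rho z y Hrho Hz Hy.
  pose proof (Cmod_ge_0 z) as Hz0.
  assert (Dz : in_disc z) by (unfold in_disc; lra).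
  assert (Dy : in_disc y) by (unfold in_disc; lra).
  pose proof (is_series_minus (K := C_AbsRing) (V := C_NormedModule) _ _ _ _
    (taylor_tail_series f a z H Dz) (taylor_tail_series f a y H Dy)) as HS.
  rewrite !Rmult_assoc.
  apply (C_series_geometric_bound _ _ _ HS). intros k.
  change (Cmod (z ^ S (3 + k) * a (4 + k)%nat - y ^ S (3 + k) * a (4 + k)%nat)
          <= M * (256 * (rho ^ 3 * Cmod (z - y))) * (1 / 2) ^ k)%R.
  replace (z ^ S (3 + k) * a (4 + k)%nat - y ^ S (3 + k) * a (4 + k)%nat)
    with (a (4 + k)%nat * (z ^ S (3 + k) - y ^ S (3 + k))) by ring.
  rewrite Cmod_mult.
  pose proof (Cpow_diff_bound z y rho (3 + k) Hz Hy) as H1.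
  pose proof (Ha (4 + k)%nat) as H2.
  pose proof (Cmod_ge_0 (z - y)) as Hd.
  assert (H3 : (INR (S (3 + k)) * rho ^ (3 + k) * Cmod (z - y)
                <= 2 ^ (4 + k) * rho ^ (3 + k) * Cmod (z - y))%R).
  { apply Rmult_le_compat_r; [exact Hd|]. apply Rmult_le_compat_r; [apply pow_le; lra|].
    apply (INR_le_pow2 (4 + k)). }
  eapply Rle_trans.
  { apply Rmult_le_compat; [apply Cmod_ge_0|apply Cmod_ge_0|exact H2|].
    eapply Rle_trans; [exact H1|exact H3]. }
  replace (M * 2 ^ (4 + k) * (2 ^ (4 + k) * rho ^ (3 + k) * Cmod (z - y)))%R
    with (M * (256 * (rho ^ 3 * Cmod (z - y))) * (4 * rho) ^ k)%R.
  - apply Rmult_le_compat_l.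
    + assert (0 <= rho ^ 3)%R by (apply pow_le; lra).
      apply Rmult_le_pos; [lra|]. apply Rmult_le_pos; [lra|]. apply Rmult_le_pos; assumption.
    + apply pow_incr. lra.
  - rewrite !pow_add, Rpow_mult_distr.
    replace (4 ^ k)%R with (2 ^ k * 2 ^ k)%R; [ring|].
    rewrite <- Rpow_mult_distr. replace (2 * 2)%R with 4%R by ring. reflexivity.
Qed.

Lemma derivative_lipschitz_bound : forall (g : C -> C) (z l : C) (L d : R),
  @is_derive C_AbsRing C_NormedModule g z l -> (0 < d)%R ->
  (forall y, (Cmod (y - z) < d)%R -> (Cmod (g y - g z) <= L * Cmod (y - z))%R) ->
  (Cmod l <= L)%R.
Proof.
  intros g z l L d Hg Hd HL. apply Rnot_lt_le; intros Hlt.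
  destruct (proj1 (is_derive_C_iff _ _ _) Hg ((Cmod l - L) / 2)%R ltac:(lra)) as [e [He H]].
  set (t := (Rmin d e / 2)%R).
  pose proof (Rmin_pos d e Hd He). pose proof (Rmin_l d e). pose proof (Rmin_r d e).
  assert (Ht : (0 < t)%R) by (unfold t; lra).
  assert (E : z + RtoC t - z = RtoC t) by ring.
  specialize (HL (z + RtoC t)). specialize (H (z + RtoC t)).
  rewrite E, Cmod_R, Rabs_pos_eq in HL, H by lra.
  specialize (HL ltac:(unfold t; lra)). specialize (H ltac:(unfold t; lra)).
  pose proof (Cmod_minus_ge (l * RtoC t) (g (z + RtoC t) - g z)) as T.
  rewrite Cmod_mult, Cmod_R, Rabs_pos_eq in T by lra.
  nra.
Qed.

Definition cubic_derive (a : nat -> C) (z : C) : C :=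
  a 1%nat + z * (2 * a 2%nat + z * (3 * a 3%nat)).

Lemma is_derive_cubic : forall a z,
  @is_derive C_AbsRing C_NormedModule (cubic a) z (cubic_derive a z).
Proof.
  intros a z.
  assert (Hstep : forall (c : C) (g : C -> C) (dg : C),
    @is_derive C_AbsRing C_NormedModule g z dg ->
    @is_derive C_AbsRing C_NormedModule (fun x => c + x * g x) z (g z + z * dg)).
  { intros c g dg Hg. apply is_derive_C_ring. apply is_derive_C_ring in Hg.
    pose proof (is_derive_plus (K := C_AbsRing) (V := AbsRing_NormedModule C_AbsRing) (fun _ => c) _ z _ _ (is_derive_const (K := C_AbsRing) (V := AbsRing_NormedModule C_AbsRing) c z)
      (@is_derive_mult C_AbsRing (fun x => x) g z _ _ (is_derive_id z) Hg Cmult_comm)) as K.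
    replace (g z + z * dg) with (0 + (1 * g z + z * dg)) by ring. exact K. }
  pose proof (is_derive_const (K := C_AbsRing) (V := C_NormedModule) (a 3%nat) z) as H3.
  apply (Hstep (a 2%nat)) in H3. apply (Hstep (a 1%nat)) in H3. apply (Hstep (a 0%nat)) in H3.
  match type of H3 with is_derive _ _ ?l => replace (cubic_derive a z) with l; [exact H3|] end.
  change (@zero C_NormedModule) with (RtoC 0). unfold cubic_derive. ring.
Qed.

(** The derivative of the tail at [z] is bounded by any Lipschitz constant of
    the tail near [z]. *)
Lemma C_derive_taylor_bound : forall f a, taylor_expansion f a -> analytic_on_disc f ->
  exists K, (0 < K)%R /\ forall (rho : R) (z : C), (rho <= 1 / 8)%R -> (Cmod z < rho)%R ->
    (Cmod (C_derive f z - cubic_derive a z) <= K * rho ^ 3)%R.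
Proof.
  intros f a H Hf. destruct (taylor_tail_lipschitz f a H) as [K [HK HL]].
  exists K; split; [exact HK|]. intros rho z Hrho Hz.
  assert (Dz : in_disc z) by (unfold in_disc; lra).
  pose proof (is_derive_minus (K := C_AbsRing) (V := C_NormedModule) _ _ _ _ _
    (C_derive_correct f z 0 (Hf z Dz)) (is_derive_cubic a z)) as HD.
  apply (derivative_lipschitz_bound (fun y => f y - cubic a y) z _ _ (rho - Cmod z) HD); [lra|].
  intros y Hy. apply HL; [exact Hrho| |lra].
  pose proof (Cmod_triangle z (y - z)) as T. replace (z + (y - z)) with y in T by ring. lra.
Qed.

Lemma taylor_coef_1 : forall f a, taylor_expansion f a -> analytic_on_disc f ->
  C_derive f 0 = a 1%nat.
Proof.
  intros f a H Hf. destruct (C_derive_taylor_bound f a H Hf) as [K [HK HB]].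
  assert (E : C_derive f 0 - cubic_derive a 0 = 0).
  { apply Cmod_eq_0. apply Rle_antisym; [|apply Cmod_ge_0]. apply Rnot_lt_le; intros Hp.
    set (m := Cmod (C_derive f 0 - cubic_derive a 0)) in *.
    set (rho := Rmin (1 / 8) (m / (K + 1))).
    assert (Hq : (0 < m / (K + 1))%R) by (apply Rdiv_lt_0_compat; lra).
    assert (H0 : (0 < rho)%R) by (apply Rmin_pos; lra).
    assert (H8 : (rho <= 1 / 8)%R) by apply Rmin_l.
    assert (Hm : (rho * (K + 1) <= m)%R).
    { replace m with (m / (K + 1) * (K + 1))%R at 1 by (field; lra).
      apply Rmult_le_compat_r; [lra|apply Rmin_r]. }
    specialize (HB rho 0 H8). rewrite Cmod_0 in HB. specialize (HB H0). fold m in HB.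
    assert (H3 : (rho ^ 3 <= rho)%R) by (simpl; nra).
    apply (Rmult_le_compat_l K) in H3; lra. }
  replace (C_derive f 0) with (C_derive f 0 - cubic_derive a 0 + cubic_derive a 0) by ring.
  rewrite E. unfold cubic_derive. ring.
Qed.

Lemma jet2_of_remainder : forall F c0 c1 c2 K, (0 < K)%R ->
  near_0 (fun z => Cmod (F z - (c0 + z * (c1 + z * c2))) <= K * Cmod z ^ 3)%R ->
  jet2 F c0 c1 c2.
Proof.
  intros F c0 c1 c2 K HK H.
  exists (fun z => if Ceq_dec z 0 then c2 else (F z - c0 - c1 * z) / (z * z)). split.
  - intros eps He.
    assert (Hq : (0 < eps / K)%R) by (apply Rdiv_lt_0_compat; lra).
    assert (HN : near_0 (fun z => Cmod z < eps / K)%R) by (exists (eps / K)%R; auto).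
    eapply near_0_imp; [|exact (near_0_and _ _ H HN)]. cbv beta. intros z [H1 H2].
    destruct (Ceq_dec z 0) as [E|N].
    + replace (c2 - c2) with (RtoC 0) by ring. rewrite Cmod_0. exact He.
    + replace (F z - (c0 + z * (c1 + z * c2))) with (z * z * ((F z - c0 - c1 * z) / (z * z) - c2)) in H1
        by (field; exact N).
      rewrite !Cmod_mult in H1. pose proof (proj1 (Cmod_gt_0 z) N) as Hp.
      apply Rle_lt_trans with (K * Cmod z)%R.
      * apply (Rmult_le_reg_l (Cmod z * Cmod z)); [nra|]. simpl in H1. lra.
      * apply (Rmult_lt_compat_r K) in H2; [|exact HK].
        replace (eps / K * K)%R with eps in H2 by (field; lra). lra.
  - eapply near_0_imp; [|exact H]. cbv beta. intros z Hz.
    destruct (Ceq_dec z 0) as [E|N]; [|field; exact N].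
    rewrite E in *. rewrite Cmod_0 in Hz. simpl in Hz.
    assert (Z : F 0 - (c0 + 0 * (c1 + 0 * c2)) = 0).
    { apply Cmod_eq_0. pose proof (Cmod_ge_0 (F 0 - (c0 + 0 * (c1 + 0 * c2)))). lra. }
    replace (F 0) with (F 0 - (c0 + 0 * (c1 + 0 * c2)) + c0) by ring. rewrite Z. ring.
Qed.

Lemma taylor_remainder_bound : forall f a, taylor_expansion f a ->
  exists K, (0 < K)%R /\ forall z, (Cmod z <= 1 / 8)%R ->
    (Cmod (f z - cubic a z) <= K * Cmod z ^ 4)%R.
Proof.
  intros f a H. destruct (taylor_tail_lipschitz f a H) as [K [HK HL]].
  exists K; split; [exact HK|]. intros z Hz.
  specialize (HL (Cmod z) z 0 Hz (Rle_refl _)). rewrite Cmod_0 in HL.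
  specialize (HL (Cmod_ge_0 z)).
  replace (f 0 - cubic a 0) with (RtoC 0) in HL
    by (unfold cubic; rewrite (taylor_coef_0 f a H); ring).
  replace (f z - cubic a z - 0) with (f z - cubic a z) in HL by ring.
  replace (z - 0) with z in HL by ring.
  replace (Cmod z ^ 4)%R with (Cmod z ^ 3 * Cmod z)%R by ring. lra.
Qed.

Lemma jet2_taylor : forall f a, taylor_expansion f a ->
  jet2 f (a 0%nat) (a 1%nat) (a 2%nat).
Proof.
  intros f a H. destruct (taylor_remainder_bound f a H) as [K [HK HB]].
  pose proof (Cmod_ge_0 (a 3%nat)) as H3.
  apply (jet2_of_remainder _ _ _ _ (K + Cmod (a 3%nat))); [lra|].
  exists (1 / 8)%R; split; [lra|]. intros z Hz. specialize (HB z ltac:(lra)).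
  replace (f z - (a 0%nat + z * (a 1%nat + z * a 2%nat)))
    with ((f z - cubic a z) + z ^ 3 * a 3%nat) by (unfold cubic; simpl; ring).
  eapply Rle_trans; [apply Cmod_triangle|]. rewrite Cmod_mult, Cmod_pow.
  pose proof (Cmod_ge_0 z) as H0. pose proof (pow_le _ 3 H0).
  assert (Cmod z ^ 4 <= Cmod z ^ 3)%R.
  { replace (Cmod z ^ 4)%R with (Cmod z ^ 3 * Cmod z)%R by ring. nra. }
  nra.
Qed.

(** The tail bound is used with twice the modulus of [z] as radius, which
    explains the factor 8. *)
Lemma jet2_C_derive : forall f a, taylor_expansion f a -> analytic_on_disc f ->
  jet2 (C_derive f) (a 1%nat) (2 * a 2%nat) (3 * a 3%nat).
Proof.
  intros f a H Hf. destruct (C_derive_taylor_bound f a H Hf) as [K [HK HB]].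
  apply (jet2_of_remainder _ _ _ _ (K * 8)); [lra|].
  exists (1 / 16)%R; split; [lra|]. intros z Hz.
  destruct (Ceq_dec z 0) as [->|N].
  - rewrite (taylor_coef_1 f a H Hf).
    replace (a 1%nat - (a 1%nat + 0 * (2 * a 2%nat + 0 * (3 * a 3%nat)))) with (RtoC 0) by ring.
    rewrite Cmod_0. simpl. lra.
  - pose proof (proj1 (Cmod_gt_0 z) N) as Hp.
    specialize (HB (2 * Cmod z)%R z ltac:(lra) ltac:(lra)). unfold cubic_derive in HB.
    replace (K * 8 * Cmod z ^ 3)%R with (K * (2 * Cmod z) ^ 3)%R by ring. exact HB.
Qed.

Lemma jet2_quotient_by_id : forall f a, taylor_expansion f a -> a 0%nat = 0 ->
  jet2 (fun z => if Ceq_dec z 0 then a 1%nat else f z / z) (a 1%nat) (a 2%nat) (a 3%nat).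
Proof.
  intros f a H H0. destruct (taylor_remainder_bound f a H) as [K [HK HB]].
  apply (jet2_of_remainder _ _ _ _ K); [lra|].
  exists (1 / 8)%R; split; [lra|]. intros z Hz. specialize (HB z ltac:(lra)).
  destruct (Ceq_dec z 0) as [->|N].
  - replace (a 1%nat - (a 1%nat + 0 * (a 2%nat + 0 * a 3%nat))) with (RtoC 0) by ring.
    rewrite Cmod_0. simpl. lra.
  - pose proof (proj1 (Cmod_gt_0 z) N) as Hp.
    unfold cubic in HB. rewrite H0 in HB.
    replace (f z - (0 + z * (a 1%nat + z * (a 2%nat + z * a 3%nat))))
      with (z * (f z / z - (a 1%nat + z * (a 2%nat + z * a 3%nat)))) in HB by (field; exact N).
    rewrite Cmod_mult in HB. apply (Rmult_le_reg_l (Cmod z)); [exact Hp|].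
    replace (Cmod z * (K * Cmod z ^ 3))%R with (K * Cmod z ^ 4)%R by ring. exact HB.
Qed.

(** * Starlike quotients and subordination *)

Lemma C_1_neq_0 : RtoC 1 <> 0.
Proof. intros E. apply RtoC_inj in E. lra. Qed.

(** The quotient is [f'(z)] divided by [f(z) / z], and both factors have jets
    read off from the Taylor series. *)
Lemma jet2_starlike_quotient : forall f a, taylor_expansion f a -> class_A f ->
  injective_on_disc f ->
  jet2 (starlike_quotient f) 1 (a 2%nat) (2 * a 3%nat - a 2%nat * a 2%nat).
Proof.
  intros f a H [Hf [H0 H1]] Hinj.
  assert (A0 : a 0%nat = 0) by (rewrite (taylor_coef_0 f a H); exact H0).
  assert (A1 : a 1%nat = 1) by (rewrite <- (taylor_coef_1 f a H Hf); exact H1).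
  pose proof (jet2_C_derive f a H Hf) as J1.
  pose proof (jet2_quotient_by_id f a H A0) as J2. rewrite A1 in J1, J2.
  pose proof (jet2_mult _ _ _ _ _ _ _ _ J1 (jet2_inv _ _ _ J2)) as J3.
  eapply jet2_ext; [|apply (jet2_coef _ _ _ _ _ _ _ J3); ring].
  eapply near_0_imp; [|exact near_0_in_disc]. intros z Hz. unfold starlike_quotient.
  destruct (Ceq_dec z 0) as [->|N].
  - rewrite H1. field.
  - assert (f z <> 0).
    { rewrite <- H0. intros E. apply N, (Hinj z 0 Hz in_disc_0 E). }
    field. auto.
Qed.

Lemma extends_inverse_0 : forall f g, bi_univalent_with_inverse f g -> g 0 = 0.
Proof.
  intros f g [[_ [H0 _]] [[_ Hinj] [_ [r [Hr Hg]]]]].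
  destruct (Hg 0) as [Hd He]; [rewrite Cmod_0; exact Hr|].
  apply Hinj; [exact Hd|exact in_disc_0|]. rewrite He, H0. reflexivity.
Qed.

(** With [z = g w], the chain rule [f'(z) g'(w) = 1] turns [w g'(w) / g(w)]
    into [f(z) / (z f'(z))]. The quotient of the inverse is thus obtained from
    that of [f] without a third-order expansion of [g]. *)
Lemma starlike_quotient_inverse : forall f g, bi_univalent_with_inverse f g ->
  near_0 (fun w => / starlike_quotient f (g w) = starlike_quotient g w).
Proof.
  intros f g Hb. pose proof (extends_inverse_0 f g Hb) as Hg0.
  destruct Hb as [[_ [H0 _]] [[Hf Hinj] [[Hg _] [r [Hr Hfg]]]]].
  apply (near_0_imp (fun w => in_disc w /\ Cmod w < r)%R);
    [|apply near_0_and; [exact near_0_in_disc|exists r; auto]].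
  intros w [Hw Hwr]. unfold starlike_quotient.
  destruct (Ceq_dec w 0) as [->|N].
  { rewrite Hg0. destruct (Ceq_dec 0 0) as [_|K]; [field|destruct (K eq_refl)]. }
  destruct (Hfg w Hwr) as [Hd He].
  assert (Ng : g w <> 0) by (intros E; rewrite E, H0 in He; auto).
  destruct (Ceq_dec (g w) 0) as [K|_]; [contradiction|].
  rewrite He.
  assert (Chain : C_derive f (g w) * C_derive g w = 1).
  { pose proof (C_derive_correct f _ 0 (Hf _ Hd)) as Df.
    pose proof (C_derive_correct g _ 0 (Hg _ Hw)) as Dg. apply is_derive_C_ring in Dg.
    pose proof (is_derive_comp (K := C_AbsRing) (V := C_NormedModule) f g w _ _ Df Dg) as D1.
    (* Near [w] the composite is the identity. *)
    assert (D2 : @is_derive C_AbsRing C_NormedModule (fun x => f (g x)) w (RtoC 1)).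
    { apply is_derive_C_iff. intros eps Heps. exists (r - Cmod w)%R; split; [lra|].
      intros y Hy.
      pose proof (Cmod_triangle w (y - w)) as T. replace (w + (y - w)) with y in T by ring.
      destruct (Hfg y ltac:(lra)) as [_ Ey]. rewrite Ey, He.
      replace (y - w - 1 * (y - w)) with (RtoC 0) by ring. rewrite Cmod_0.
      apply Rmult_le_pos; [lra|apply Cmod_ge_0]. }
    rewrite <- (is_C_derive_unique _ _ _ D2), (is_C_derive_unique _ _ _ D1).
    apply Cmult_comm. }
  assert (Nf : C_derive f (g w) <> 0).
  { intros E. rewrite E, Cmult_0_l in Chain. symmetry in Chain. exact (C_1_neq_0 Chain). }
  replace (C_derive g w) with (/ C_derive f (g w)).
  - field. auto.
  - replace (/ C_derive f (g w)) with (/ C_derive f (g w) * (C_derive f (g w) * C_derive g w)).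
    + field. exact Nf.
    + rewrite Chain. ring.
Qed.

Lemma jet2_starlike_quotient_inverse : forall f g a, taylor_expansion f a ->
  bi_univalent_with_inverse f g ->
  jet2 (starlike_quotient g) 1 (- a 2%nat) (3 * (a 2%nat * a 2%nat) - 2 * a 3%nat).
Proof.
  intros f g a H Hb. pose proof (extends_inverse_0 f g Hb) as Hg0.
  pose proof (starlike_quotient_inverse f g Hb) as Hquot.
  destruct Hb as [HA [[Hf Hinj] [[Hg _] [r [Hr Hfg]]]]].
  pose proof (jet2_taylor f a H) as Jf.
  rewrite (taylor_coef_0 f a H), <- (taylor_coef_1 f a H Hf) in Jf.
  pose proof HA as [_ [H0 H1]]. rewrite H0, H1 in Jf.
  assert (Jid : jet2 (fun w => f (g w)) 0 1 0).
  { eapply jet2_ext; [|exact (jet2_affine 0 1)]. exists r; split; [exact Hr|].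
    intros w Hw. destruct (Hfg w Hw) as [_ ->]. ring. }
  pose proof (jet2_solve f g 0 1 _ 1 0 Jf C_1_neq_0 (Hg 0 in_disc_0) Hg0 Jid) as Jg.
  pose proof (jet2_comp _ g _ _ _ _ _ (jet2_starlike_quotient f a H HA Hinj) Jg) as JQ.
  eapply jet2_ext; [exact Hquot|].
  apply (jet2_coef _ _ _ _ _ _ _ (jet2_inv _ _ _ JQ)); [reflexivity| |]; field.
Qed.

(** The Schwarz function [w] has an expansion because [phi] is locally
    invertible at 0; comparing [Q] with [phi o w] gives the two equations, and
    [w] obeys the Schwarz bounds. *)
Lemma subordinate_coefficients : forall Q phi B q1 q2, subordinate Q phi ->
  taylor_expansion phi B -> B 1%nat <> 0 -> jet2 Q (B 0%nat) q1 q2 ->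
  exists u1 u2 : C, (Cmod u1 <= 1)%R /\ (Cmod (u2 + u1 * u1) <= 1)%R /\
    q1 = B 1%nat * u1 /\ q2 = B 1%nat * u2 + B 2%nat * (u1 * u1).
Proof.
  intros Q phi B q1 q2 [w [Hw [Hmap [Hw0 HQ]]]] HB HB1 JQ.
  assert (Jc : jet2 (fun z => phi (w z)) (B 0%nat) q1 q2).
  { eapply jet2_ext; [|exact JQ]. eapply near_0_imp; [|exact near_0_in_disc].
    intros z Hz. apply HQ, Hz. }
  pose proof (jet2_solve phi w _ _ _ _ _ (jet2_taylor phi B HB) HB1 (Hw 0 in_disc_0) Hw0 Jc) as Jw.
  destruct (schwarz_coefficients w _ _ Hw Hmap Hw0 Jw) as [S1 S2].
  eexists; eexists; split; [exact S1|split; [exact S2|]]. split; field; exact HB1.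
Qed.

(** * The coefficient bounds *)

(* B 1 = phi'(0) is a positive real number, so Re (B 1) is B_1 as a real. *)
Theorem corollary2p1 :
  forall (phi f : C -> C) (B a : nat -> C),
    ma_minda phi ->
    taylor_expansion phi B ->
    taylor_expansion f a ->
    ST_sigma phi f ->
    (B 1%nat * B 1%nat + B 1%nat - B 2%nat <> 0 ->
       (Cmod (a 2%nat) <=
          Re (B 1%nat) * sqrt (Re (B 1%nat)) /
          sqrt (Cmod (B 1%nat * B 1%nat + B 1%nat - B 2%nat)))%R) /\
    (Cmod (a 3%nat) <= Re (B 1%nat) + Cmod (B 2%nat - B 1%nat))%R.
Proof.
  intros phi f B a [Hphi [_ [Hphi0 [[HIm HRe] _]]]] HB Ha [g [Hb [Sf Sg]]].
  rewrite (taylor_coef_1 phi B HB Hphi) in HIm, HRe.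
  assert (HB0 : B 0%nat = 1) by (rewrite (taylor_coef_0 phi B HB); exact Hphi0).
  assert (HBm : Cmod (B 1%nat) = Re (B 1%nat)).
  { destruct (B 1%nat) as [x y]; unfold Re, Im in *; simpl in *. rewrite HIm.
    change (x, 0%R) with (RtoC x). rewrite Cmod_R. apply Rabs_pos_eq. lra. }
  assert (HB1 : B 1%nat <> 0) by (apply Cmod_gt_0; lra).
  pose proof Hb as [HA [[_ Hinj] _]].
  pose proof (jet2_starlike_quotient f a Ha HA Hinj) as Jf.
  pose proof (jet2_starlike_quotient_inverse f g a Ha Hb) as Jg.
  rewrite <- HB0 in Jf, Jg.
  destruct (subordinate_coefficients _ _ _ _ _ Sf HB HB1 Jf) as [u1 [u2 [U1 [U2 [E1 E2]]]]].
  destruct (subordinate_coefficients _ _ _ _ _ Sg HB HB1 Jg) as [v1 [v2 [V1 [V2 [E3 E4]]]]].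
  assert (Ev : v1 = - u1).
  { replace v1 with (/ B 1%nat * (B 1%nat * v1)) by (field; exact HB1).
    rewrite <- E3, E1. field. exact HB1. }
  subst v1.
  set (b := Re (B 1%nat)) in *. set (b1 := B 1%nat) in *. set (b2 := B 2%nat) in *.
  set (s := u2 + u1 * u1) in *. set (t := v2 + - u1 * - u1) in *.
  set (X := b1 * b1 + b1 - b2).
  assert (T2 : 2 * (a 2%nat * a 2%nat) * X = b1 * b1 * b1 * (s + t)).
  { assert (K : 2 * (a 2%nat * a 2%nat) = b1 * (s + t) + 2 * (b2 - b1) * (u1 * u1)).
    { replace (2 * (a 2%nat * a 2%nat)) with
        ((2 * a 3%nat - a 2%nat * a 2%nat) + (3 * (a 2%nat * a 2%nat) - 2 * a 3%nat)) by ring.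
      rewrite E2, E4. unfold s, t. ring. }
    unfold X. replace (b1 * b1 * b1 * (s + t)) with
      (b1 * b1 * (b1 * (s + t) + 2 * (b2 - b1) * (u1 * u1)) + 2 * (b1 * u1 * (b1 * u1)) * (b1 - b2)) by ring.
    rewrite <- K, <- E1. ring. }
  assert (T3 : 4 * a 3%nat = b1 * (3 * s + t) + 4 * ((b2 - b1) * (u1 * u1))).
  { replace (4 * a 3%nat) with
      (3 * (2 * a 3%nat - a 2%nat * a 2%nat) + (3 * (a 2%nat * a 2%nat) - 2 * a 3%nat)) by ring.
    rewrite E2, E4. unfold s, t. ring. }
  assert (Hst : (Cmod (s + t) <= 2)%R) by (eapply Rle_trans; [apply Cmod_triangle|lra]).
  split.
  - intros HX. fold X in HX |- *.
    assert (HX0 : (0 < Cmod X)%R) by (apply Cmod_gt_0, HX).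
    apply (f_equal Cmod) in T2. rewrite !Cmod_mult, HBm, Cmod_R, Rabs_pos_eq in T2 by lra.
    set (A := Cmod (a 2%nat)) in *.
    assert (HA0 : (0 <= A)%R) by apply Cmod_ge_0.
    assert (Hbb : (0 < b * b * b)%R) by (repeat apply Rmult_lt_0_compat; exact HRe).
    assert (HAX : (A * A * Cmod X <= b * b * b)%R) by nra.
    pose proof (sqrt_lt_R0 _ HX0) as HsX.
    apply (Rmult_le_reg_r (sqrt (Cmod X))); [exact HsX|].
    unfold Rdiv. rewrite Rmult_assoc, Rinv_l, Rmult_1_r by lra.
    apply sqrt_le_1_alt in HAX.
    rewrite (sqrt_mult (A * A)), (sqrt_mult (b * b)), !sqrt_square in HAX by nra.
    exact HAX.
  - apply (f_equal Cmod) in T3. rewrite Cmod_mult, Cmod_R, Rabs_pos_eq in T3 by lra.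
    pose proof (Cmod_triangle (b1 * (3 * s + t)) (4 * ((b2 - b1) * (u1 * u1)))) as K.
    rewrite !Cmod_mult, HBm, Cmod_R, (Rabs_pos_eq 4) in K by lra.
    assert (K1 : (Cmod (3 * s + t) <= 4)%R).
    { eapply Rle_trans; [apply Cmod_triangle|]. rewrite Cmod_mult, Cmod_R, Rabs_pos_eq by lra. lra. }
    pose proof (Cmod_ge_0 u1). pose proof (Cmod_ge_0 (b2 - b1)).
    assert (K2 : (Cmod (b2 - b1) * (Cmod u1 * Cmod u1) <= Cmod (b2 - b1) * 1)%R)
      by (apply Rmult_le_compat_l; nra).
    assert (K3 : (b * Cmod (3 * s + t) <= b * 4)%R) by (apply Rmult_le_compat_l; lra).
    lra.
Qed.
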